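(* Let $k\ge2$ be an integer and $\lambda=\lambda_{k,1}$. The Veech group of the ladder surface $X_\lambda$ is generated by the parabolic element $$P=\begin{pmatrix}1&k(\lambda+1)\\0&1\end{pmatrix}$$ and the elliptic element $$R=\begin{pmatrix}-1&-1\\1&0\end{pmatrix}.$$ In particular, for $k=2$, i.e. $\lambda=(\sqrt5-1)/2$ (the golden ladder), the Veech group is generated by $\begin{pmatrix}1&2(\lambda+1)\\0&1\end{pmatrix}$ and $R$.
   Context: Notation: for $\lambda>0$ put $s_{-1}=0$ and $s_n=\sum_{i=0}^{n}\lambda^i$ for $n\ge 0$. Let $L_\lambda$ be the infinite polygonal path with consecutive vertices $(0,0),(s_0,0)$ and then, for $n\ge1$, the two vertices $(s_n,s_{n-2})$ and $(s_n,s_{n-1})$. Let $U_\lambda$ be its reflection in the line $y=x$. The \emph{ladder surface} $X_\lambda$ is the translation surface obtained from the open region bounded by $L_\lambda$ and $U_\lambda$ by identifying, via translation, each edge of $L_\lambda$ with the edge of $U_\lambda$ that is parallel to it and of the same length. Vertices are not points of $X_\lambda$. For coprime integers $k>l>0$, $\lambda_{k,l}$ denotes the positive solution of $k(\lambda+1)=l(\lambda^{-1}+1+\lambda)$. An affine homeomorphism is one that is locally of the form $z\mapsto Az+t$ in translation charts; the matrix $A$ is its derivative. The Veech group is the image in $\mathrm{PSL}(2,\mathbb{R})$ of the derivatives of orientation-preserving affine homeomorphisms of $X_\lambda$. *)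

(* Defs.v *)
From Stdlib Require Import Reals Lra ZArith.
Open Scope R_scope.

Definition pt := (R * R)%type.
Definition padd (p q : pt) : pt := (fst p + fst q, snd p + snd q).
Definition psub (p q : pt) : pt := (fst p - fst q, snd p - snd q).
Definition pscale (t : R) (p : pt) : pt := (t * fst p, t * snd p).
Definition pnorm (p : pt) : R := sqrt (fst p * fst p + snd p * snd p).
Definition swap (p : pt) : pt := (snd p, fst p).

Record Mat := mkMat { a11 : R; a12 : R; a21 : R; a22 : R }.
Definition mapply (A : Mat) (v : pt) : pt :=
  (a11 A * fst v + a12 A * snd v, a21 A * fst v + a22 A * snd v).
Definition mmul (A B : Mat) : Mat :=
  mkMat (a11 A * a11 B + a12 A * a21 B) (a11 A * a12 B + a12 A * a22 B)
        (a21 A * a11 B + a22 A * a21 B) (a21 A * a12 B + a22 A * a22 B).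
Definition mdet (A : Mat) : R := a11 A * a22 A - a12 A * a21 A.
Definition mid : Mat := mkMat 1 0 0 1.
Definition mopp (A : Mat) : Mat := mkMat (- a11 A) (- a12 A) (- a21 A) (- a22 A).
Definition minv (A : Mat) : Mat :=
  let d := mdet A in mkMat (a22 A / d) (- a12 A / d) (- a21 A / d) (a11 A / d).

Inductive gen_by (S : Mat -> Prop) : Mat -> Prop :=
| gen_base M : S M -> gen_by S M
| gen_one : gen_by S mid
| gen_mul M N : gen_by S M -> gen_by S N -> gen_by S (mmul M N)
| gen_inv M : gen_by S M -> gen_by S (minv M).

Definition is_lambda_kl (k l : nat) (lam : R) : Prop :=
  0 < lam /\ INR k * (lam + 1) = INR l * (/ lam + 1 + lam).

(* s n = sum_{i=0}^n lam^i for n >= 0; s n = 0 for n < 0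
   (the paper only uses s_{-1} = 0; s_{-2} := 0 is used internally below to
   describe the region compactly). *)
Definition s (lam : R) (n : Z) : R :=
  if (n <? 0)%Z then 0 else sum_f_R0 (fun i => lam ^ i) (Z.to_nat n).

(* Consecutive vertices of L_lam: (0,0), (s_0,0), then for n >= 1
   (s_n, s_{n-2}) [index 2n] and (s_n, s_{n-1}) [index 2n+1]. *)
Definition vL (lam : R) (j : nat) : pt :=
  match j with
  | O => (0, 0)
  | S O => (s lam 0, 0)
  | _ => let n := Z.of_nat (Nat.div2 j) in
         if Nat.even j then (s lam n, s lam (n - 2))
         else (s lam n, s lam (n - 1))
  end.

Definition vU (lam : R) (j : nat) : pt := swap (vL lam j).

Definition cseg (a b z : pt) : Prop :=
  exists t, 0 <= t <= 1 /\ z = padd a (pscale t (psub b a)).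
Definition oseg (a b z : pt) : Prop :=
  exists t, 0 < t < 1 /\ z = padd a (pscale t (psub b a)).

(* The open region bounded by L_lam and U_lam (written out explicitly:
   above the staircase L and to the right of the staircase U). *)
Definition Omega (lam : R) (p : pt) : Prop :=
  (exists n : nat, s lam (Z.of_nat n - 1) <= fst p < s lam (Z.of_nat n) /\
                   s lam (Z.of_nat n - 2) < snd p) /\
  (exists m : nat, s lam (Z.of_nat m - 1) <= snd p < s lam (Z.of_nat m) /\
                   s lam (Z.of_nat m - 2) < fst p).

Definition Dom (lam : R) (p : pt) : Prop :=
  Omega lam p \/
  (exists i, oseg (vL lam i) (vL lam (S i)) p) \/
  (exists j, oseg (vU lam j) (vU lam (S j)) p).

(* p on (the interior of) edge i of L is glued to q on edge j of U when the
   translation by q - p carries the edge i of L onto the edge j of U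
   (i.e. the two edges are parallel, of the same length, identified by
   that translation). *)
Definition glue (lam : R) (p q : pt) : Prop :=
  exists i j, oseg (vL lam i) (vL lam (S i)) p /\
    (forall z, cseg (vL lam i) (vL lam (S i)) z <->
               cseg (vU lam j) (vU lam (S j)) (padd z (psub q p))).

Definition eqv (lam : R) (p q : pt) : Prop :=
  p = q \/ glue lam p q \/ glue lam q p.

Definition X (lam : R) : Type :=
  { C : pt -> Prop | exists p, Dom lam p /\ C = eqv lam p }.

Definition rep {lam : R} (x : X lam) (p : pt) : Prop := proj1_sig x p.

Definition bij {A B : Type} (f : A -> B) : Prop :=
  exists g : B -> A, (forall a, g (f a) = a) /\ (forall b, f (g b) = b).

(* f is an affine homeomorphism of X_lam with derivative A: f is a bijection
   which, in translation charts around every point, is z |-> A z + t. *)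
Definition affine_with (lam : R) (f : X lam -> X lam) (A : Mat) : Prop :=
  bij f /\
  forall x : X lam, exists eps, 0 < eps /\
    forall v : pt, pnorm v < eps ->
    forall r, rep x r -> Dom lam (padd r v) ->
    exists s0, rep (f x) s0 /\
      forall y : X lam, rep y (padd r v) -> rep (f y) (padd s0 (mapply A v)).

Definition derivative (lam : R) (A : Mat) : Prop :=
  exists f : X lam -> X lam, affine_with lam f A /\ 0 < mdet A.

Definition Pmat (k : nat) (lam : R) : Mat := mkMat 1 (INR k * (lam + 1)) 0 1.
Definition Rmat : Mat := mkMat (-1) (-1) 1 0.

(* Main.v *)
Require Import Defs.
From Stdlib Require Import Reals Lra Lia ZArith.
From Stdlib Require Import ClassicalEpsilon FunctionalExtensionality PropExtensionality ProofIrrelevance.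
Open Scope R_scope.

(** The surface splits into horizontal cylinders, the m-th one of height [lam^m]; as
[k (lam + 1) = 1/lam + 1 + lam], P is the multitwist along all of them. Vertically the surface
looks the same after reflection in the diagonal, and R is this reflection followed by an
affine involution that flips every horizontal saddle connection.

Conversely, let A be a derivative and (x, y) its first column. The quotient x/y never lies in
(lam, 1/lam): from every point, all short enough one-sided horizontal strips are free of
singularities, whereas along a direction of that cone the inner vertices of the polygon
accumulate at the apex of the ladder. Moreover |y| is bounded below unless y = 0, since
otherwise a closed horizontal geodesic would be too short to leave the image of the 0-th
cylinder. A Euclidean algorithm with P and R, whose steps shrink |y| as the cone is avoided,
therefore reaches y = 0. Finally, an affine map preserving the horizontal direction preserves
circumferences, hence every cylinder and every saddle connection (they are told apart by the
two cylinders adjacent to them), hence it is a power of P. *)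

(** * The sequence s *)

(** Vertices are not points of the surface and they accumulate at the apex, so no singularity is
    ever available as an object and no finite-type theory gives discreteness. Rigidity comes from
    straight paths instead: they are unique, a path that would end at a missing vertex does not
    exist, and a path that closes up shows a multiple of a circumference. The surface also carries
    no topology; the relation [disp] with its local existence, local uniqueness and separation takes
    that role.

    The lower bound on [|y|] replaces discreteness and makes the Euclidean algorithm stop. The
    algorithm fits because [k (lam + 1) = 1/lam + 1 + lam] is exactly the length of
    [[-1 - lam, 1/lam)]; without the forbidden cone [[-1 - lam, lam]] remains, and R and its square
    replace [y] by [x] and [-(x + y)].

    The threshold 2/3 follows from [(k - 1) (lam + 1) = 1/lam]. It gives [lam^2 + lam^3 < 1], which
    keeps the circumferences distinct, and it is the contraction factor of the algorithm. *)

Class ladder_ratio (lam : R) : Prop :=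
  { lam_pos : 0 < lam; lam_lt : lam < 2 / 3 }.

(* Sealed: otherwise unification identifies [lsum lam 0] with [lsum lam 1], both reducing to 0. *)
Lemma lsum_sig : { f : R -> nat -> R | forall lam n, f lam n = s lam (Z.of_nat n - 2) }.
Proof. now exists (fun lam n => s lam (Z.of_nat n - 2)). Qed.

(* Shifted so that the index is a natural number: [lsum lam n] is the paper's s_{n-2}. *)
Definition lsum : R -> nat -> R := proj1_sig lsum_sig.

Lemma lsum_def lam n : lsum lam n = s lam (Z.of_nat n - 2).
Proof. exact (proj2_sig lsum_sig lam n). Qed.

(** The n-th row of the polygon spans these two abscissas; once its vertical sides are glued, the
    difference is the length of the core curve of the n-th horizontal cylinder. *)
Definition circum (lam : R) (n : nat) : R := lsum lam (S (S (S n))) - lsum lam n.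

Section Sequence.
Context {lam : R} {Hlam : ladder_ratio lam}.
Local Notation sg := (lsum lam).
Local Notation circ := (circum lam).

Lemma sg_0 : sg 0 = 0.
Proof. apply lsum_def. Qed.

Lemma sg_1 : sg 1 = 0.
Proof. apply lsum_def. Qed.

Lemma s_nat n : s lam (Z.of_nat n) = sum_f_R0 (fun i => lam ^ i) n.
Proof.
  unfold s. destruct (Z.ltb_spec (Z.of_nat n) 0); [lia|]. now rewrite Nat2Z.id.
Qed.

Lemma sg_step n : sg (S (S n)) = sg (S n) + lam ^ n.
Proof.
  rewrite !lsum_def. replace (Z.of_nat (S (S n)) - 2)%Z with (Z.of_nat n) by lia.
  destruct n as [|n].
  - rewrite s_nat. simpl. unfold s. simpl. lra.
  - replace (Z.of_nat (S (S n)) - 2)%Z with (Z.of_nat n) by lia.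
    now rewrite !s_nat.
Qed.

Lemma lam_pow_pos n : 0 < lam ^ n.
Proof. apply pow_lt, lam_pos. Qed.

Lemma sg_2 : sg 2 = 1.
Proof. rewrite sg_step, sg_1. simpl. lra. Qed.

Lemma sg_3 : sg 3 = 1 + lam.
Proof. rewrite sg_step, sg_2. simpl. lra. Qed.

Lemma sg_lt_S n : sg (S n) < sg (S (S n)).
Proof. rewrite sg_step. pose proof (lam_pow_pos n). lra. Qed.

Lemma sg_le_S n : sg n <= sg (S n).
Proof. destruct n; [rewrite sg_0, sg_1; lra|]. left; apply sg_lt_S. Qed.

Lemma sg_le i j : (i <= j)%nat -> sg i <= sg j.
Proof.
  induction 1; [lra|]. pose proof (sg_le_S m). lra.
Qed.

Lemma sg_lt i j : (i < j)%nat -> (2 <= j)%nat -> sg i < sg j.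
Proof.
  intros H1 H2. destruct j as [|[|j]]; try lia.
  pose proof (sg_lt_S j). pose proof (sg_le i (S j) ltac:(lia)). lra.
Qed.

Lemma sg_inv_lt i j : sg i < sg j -> (i < j)%nat.
Proof.
  intros H. destruct (Nat.lt_ge_cases i j) as [?|?]; [easy|].
  pose proof (sg_le j i H0). lra.
Qed.

Lemma interval_unique i j y :
  sg (S i) < y < sg (S (S i)) -> sg (S j) <= y <= sg (S (S j)) -> i = j.
Proof.
  intros H1 H2.
  assert (S i < S (S j))%nat by (apply sg_inv_lt; lra).
  assert (S j < S (S i))%nat by (apply sg_inv_lt; lra). lia.
Qed.

(** The limit of [sg]; [(sg_lim, sg_lim)] is the apex to which the ladder shrinks. *)
Definition sg_lim := / (1 - lam).

Lemma sg_lim_pos : 0 < sg_lim.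
Proof. apply Rinv_0_lt_compat. pose proof lam_lt. lra. Qed.

Lemma sg_lim_sub n : sg_lim - sg (S n) = lam ^ n * sg_lim.
Proof.
  pose proof lam_lt. assert (1 - lam <> 0) by lra.
  induction n; [rewrite sg_1; simpl; unfold sg_lim; lra|].
  rewrite sg_step. replace (sg_lim - (sg (S n) + lam ^ n))
    with (lam ^ n * sg_lim - lam ^ n) by lra.
  simpl. unfold sg_lim. field. easy.
Qed.

Lemma interval_exists x : 0 <= x < sg_lim -> exists n, sg (S n) <= x < sg (S (S n)).
Proof.
  intros [H0 H1]. pose proof lam_lt. pose proof lam_pos. pose proof sg_lim_pos.
  assert (exists N, x < sg (S N)) as [N HN].
  { destruct (pow_lt_1_zero lam ltac:(rewrite Rabs_right; lra) ((sg_lim - x) / sg_lim)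
      ltac:(apply Rdiv_lt_0_compat; lra)) as [N HN].
    specialize (HN N (Nat.le_refl N)). exists N.
    rewrite Rabs_right in HN by (left; apply lam_pow_pos).
    pose proof (sg_lim_sub N).
    apply (Rmult_lt_compat_r sg_lim) in HN; [|easy].
    unfold Rdiv in HN. rewrite Rmult_assoc, Rinv_l in HN by lra. lra. }
  induction N; [rewrite sg_1 in HN; lra|].
  destruct (Rlt_dec x (sg (S N))) as [G|G]; [auto|].
  exists N. lra.
Qed.

Lemma circ_0 : circ 0 = 1 + lam.
Proof. unfold circum. rewrite sg_3, sg_0. lra. Qed.

Lemma circ_S n : circ (S n) = lam ^ n * (1 + lam + lam ^ 2).
Proof. unfold circum. rewrite !sg_step. simpl. ring. Qed.

Lemma circ_pos n : 0 < circ n.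
Proof. unfold circum. pose proof (sg_lt n (S (S (S n))) ltac:(lia) ltac:(lia)). lra. Qed.

Lemma circ_S_lt i j : (i < j)%nat -> circ (S j) < circ (S i).
Proof.
  intros H. pose proof lam_pos. pose proof lam_lt.
  assert (E : forall n, circ (S (S n)) < circ (S n)).
  { intros n. pose proof (circ_pos (S n)).
    replace (circ (S (S n))) with (lam * circ (S n)) by (rewrite !circ_S; simpl; ring).
    nra. }
  induction H as [|j H IH]; [apply E|]. specialize (E j). lra.
Qed.

(** [circ 0] is outside the geometric pattern because [sg 0 = sg 1]. The comparison with
    [circ 2 = lam + lam^2 + lam^3] amounts to [lam^2 + lam^3 < 1]. *)
Lemma circ_2_lt_0 n : circ (S (S n)) < circ 0.
Proof.
  pose proof lam_pos. pose proof lam_lt.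
  apply Rle_lt_trans with (circ 2).
  - destruct n; [lra|]. left. apply circ_S_lt. lia.
  - rewrite circ_S, circ_0. simpl. nra.
Qed.

Lemma circ_0_lt_1 : circ 0 < circ 1.
Proof. rewrite circ_S, circ_0. pose proof lam_pos. simpl. nra. Qed.

Lemma circ_le_1 n : circ n <= circ 1.
Proof.
  destruct n as [|[|n]]; [left; apply circ_0_lt_1|lra|left; apply circ_S_lt; lia].
Qed.

(** The order is [circ 1 > circ 0 > circ 2 > circ 3 > ...], so a map that preserves circumferences
    recognises each cylinder. *)
Lemma circ_inj i j : circ i = circ j -> i = j.
Proof.
  intros H. pose proof circ_0_lt_1.
  destruct i as [|i], j as [|j]; [easy| | |].
  - destruct j; [lra|]. pose proof (circ_2_lt_0 j). lra.
  - destruct i; [lra|]. pose proof (circ_2_lt_0 i). lra.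
  - destruct (Nat.lt_trichotomy i j) as [G|[G|G]]; [|congruence|];
      apply circ_S_lt in G; lra.
Qed.
End Sequence.

(** * The polygon *)

Ltac sgl i j := pose proof (sg_le i j ltac:(lia)).
Ltac sgm i j := pose proof (sg_lt i j ltac:(lia) ltac:(lia)).

Lemma pt_eq (p q : pt) : fst p = fst q -> snd p = snd q -> p = q.
Proof. destruct p, q; simpl; congruence. Qed.

Lemma swap_swap p : swap (swap p) = p.
Proof. now destruct p. Qed.

Lemma swap_padd p q : swap (padd p q) = padd (swap p) (swap q).
Proof. reflexivity. Qed.

Lemma cseg_swap a b z : cseg (swap a) (swap b) (swap z) <-> cseg a b z.
Proof.
  split; intros [t [Ht E]]; exists t; split; auto.
  - rewrite <- (swap_swap z), E. reflexivity.
  - rewrite E. reflexivity.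
Qed.

Lemma oseg_swap a b z : oseg (swap a) (swap b) (swap z) <-> oseg a b z.
Proof.
  split; intros [t [Ht E]]; exists t; split; auto.
  - rewrite <- (swap_swap z), E. reflexivity.
  - rewrite E. reflexivity.
Qed.

Lemma cseg_left a b : cseg a b a.
Proof. exists 0. split; [lra|]. apply pt_eq; simpl; lra. Qed.

Lemma cseg_right a b : cseg a b b.
Proof. exists 1. split; [lra|]. apply pt_eq; simpl; lra. Qed.

Lemma cseg_h a b y z : a < b -> cseg (a, y) (b, y) z <-> a <= fst z <= b /\ snd z = y.
Proof.
  intros Hab. split.
  - intros [t [Ht ->]]. simpl. split; [|lra]. nra.
  - intros [H1 H2]. exists ((fst z - a) / (b - a)). split.
    + split.
      * apply Rmult_le_pos; [lra|]. left. apply Rinv_0_lt_compat. lra.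
      * apply Rmult_le_reg_r with (b - a); [lra|]. unfold Rdiv. rewrite Rmult_assoc, Rinv_l; lra.
    + apply pt_eq; simpl; [field; lra | lra].
Qed.

Lemma oseg_h a b y z : a < b -> oseg (a, y) (b, y) z <-> a < fst z < b /\ snd z = y.
Proof.
  intros Hab. split.
  - intros [t [Ht ->]]. simpl. split; [|lra]. nra.
  - intros [H1 H2]. exists ((fst z - a) / (b - a)). split.
    + split.
      * apply Rdiv_lt_0_compat; lra.
      * apply Rmult_lt_reg_r with (b - a); [lra|]. unfold Rdiv. rewrite Rmult_assoc, Rinv_l; lra.
    + apply pt_eq; simpl; [field; lra | lra].
Qed.

Lemma cseg_v a b x z : a < b -> cseg (x, a) (x, b) z <-> a <= snd z <= b /\ fst z = x.
Proof.
  intros H. rewrite <- cseg_swap. now apply (cseg_h a b x (swap z)).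
Qed.

Lemma oseg_v a b x z : a < b -> oseg (x, a) (x, b) z <-> a < snd z < b /\ fst z = x.
Proof.
  intros H. rewrite <- oseg_swap. now apply (oseg_h a b x (swap z)).
Qed.

Section Domain.
Context {lam : R} {Hlam : ladder_ratio lam}.
Local Notation sg := (lsum lam).
Local Notation Dom := (Dom lam).
Local Notation glue := (glue lam).

Lemma vL_even n : vL lam (2 * n + 2) = (sg (S (S (S n))), sg (S n)).
Proof.
  unfold vL. replace (2 * n + 2)%nat with (S (S (2 * n))) by lia.
  replace (S (S (2 * n))) with (2 * S n)%nat by lia.
  rewrite Nat.div2_double, Nat.even_mul. simpl orb. cbv iota.
  rewrite !lsum_def. apply f_equal2; f_equal; lia.
Qed.

Lemma vL_odd n : vL lam (2 * n + 1) = (sg (S (S n)), sg (S n)).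
Proof.
  destruct n as [|n].
  - rewrite sg_1, sg_2. simpl. unfold s. simpl. auto.
  - unfold vL. replace (2 * S n + 1)%nat with (S (S (2 * n + 1))) by lia.
    replace (S (S (2 * n + 1))) with (S (2 * S n))%nat by lia.
    rewrite Nat.div2_succ_double, Nat.even_succ, Nat.odd_mul. simpl andb. cbv iota.
    rewrite !lsum_def. apply f_equal2; f_equal; lia.
Qed.

Lemma horizontal_edge n : exists i, vL lam i = (sg (S n), sg n) /\ vL lam (S i) = (sg (S (S n)), sg n).
Proof.
  destruct n as [|n].
  - exists 0%nat. rewrite sg_0, sg_1, sg_2. simpl. unfold s. simpl. auto.
  - exists (2 * n + 1)%nat. replace (S (2 * n + 1)) with (2 * n + 2)%nat by lia.
    now rewrite vL_even, vL_odd.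
Qed.

Lemma vertical_edge m :
  exists i, vL lam i = (sg (S (S (S m))), sg (S m)) /\ vL lam (S i) = (sg (S (S (S m))), sg (S (S m))).
Proof.
  exists (2 * m + 2)%nat. replace (S (2 * m + 2)) with (2 * S m + 1)%nat by lia.
  now rewrite vL_even, vL_odd.
Qed.

Lemma edge_cases i :
  (exists n, vL lam i = (sg (S n), sg n) /\ vL lam (S i) = (sg (S (S n)), sg n)) \/
  (exists m, vL lam i = (sg (S (S (S m))), sg (S m)) /\ vL lam (S i) = (sg (S (S (S m))), sg (S (S m)))).
Proof.
  destruct (Nat.Even_or_Odd i) as [[n ->]|[n ->]].
  - destruct n as [|n].
    + left. exists 0%nat. rewrite sg_0, sg_1, sg_2. simpl. unfold s. simpl. auto.
    + right. exists n. replace (2 * S n)%nat with (2 * n + 2)%nat by lia.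
      replace (S (2 * n + 2)) with (2 * S n + 1)%nat by lia. now rewrite vL_even, vL_odd.
  - left. exists (S n). replace (S (2 * n + 1)) with (2 * n + 2)%nat by lia.
    now rewrite vL_even, vL_odd.
Qed.

(* The edge of L (resp. U) that bounds the column over [(sg (S n), sg (S (S n)))] from below (resp. above). *)
Definition lower_edge n (p : pt) := sg (S n) < fst p < sg (S (S n)) /\ snd p = sg n.
Definition upper_edge n (p : pt) := sg (S n) < fst p < sg (S (S n)) /\ snd p = sg (S (S (S n))).

(** Reflection exchanges [L] and [U], so [upper_edge m (swap p)] describes the right side of row
    [m], a vertical edge of [L]. *)
Lemma oseg_L p :
  (exists i, oseg (vL lam i) (vL lam (S i)) p) <->
  (exists n, lower_edge n p) \/ (exists m, upper_edge m (swap p)).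
Proof.
  split.
  - intros [i H]. destruct (edge_cases i) as [[n [E1 E2]]|[m [E1 E2]]]; rewrite E1, E2 in H.
    + left. exists n. apply oseg_h in H; [exact H|apply sg_lt_S].
    + right. exists m. apply oseg_v in H; [exact H|apply sg_lt_S].
  - intros [[n H]|[m H]].
    + destruct (horizontal_edge n) as [i [E1 E2]]. exists i. rewrite E1, E2.
      apply oseg_h; [apply sg_lt_S|exact H].
    + destruct (vertical_edge m) as [i [E1 E2]]. exists i. rewrite E1, E2.
      apply oseg_v; [apply sg_lt_S|exact H].
Qed.

Lemma oseg_U p :
  (exists i, oseg (vU lam i) (vU lam (S i)) p) <->
  (exists n, lower_edge n (swap p)) \/ (exists m, upper_edge m p).
Proof.
  pose proof (oseg_L (swap p)) as E. rewrite swap_swap in E. rewrite <- E.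
  split; intros [i H]; exists i; unfold vU in *.
  - now rewrite <- oseg_swap, swap_swap.
  - now rewrite <- (swap_swap p), oseg_swap.
Qed.

(** In each direction the edges have the distinct lengths [lam ^ n], so every edge of [L] has
    exactly one partner on [U]: the top of the same column or the left side of the same row. *)
Lemma glue_iff p q :
  glue p q <->
  (exists n, lower_edge n p /\ q = (fst p, sg (S (S (S n))))) \/
  (exists m, upper_edge m (swap p) /\ q = (sg m, snd p)).
Proof.
  split.
  - intros [i [j [Ho Hc]]]. unfold vU in Hc.
    assert (Hp : forall z, cseg (vL lam i) (vL lam (S i)) z <->
      cseg (vL lam j) (vL lam (S j)) (swap (padd z (psub q p)))).
    { intros z. rewrite Hc. rewrite <- cseg_swap, !swap_swap. reflexivity. }
    clear Hc.
    assert (Pow : forall a b, sg (S (S a)) - sg (S a) = sg (S (S b)) - sg (S b) -> a = b).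
    { intros a b H. rewrite !sg_step in H.
      assert (K : forall u v, (u < v)%nat -> lam ^ v < lam ^ u).
      { pose proof lam_pos. pose proof lam_lt.
        intros u v Huv. induction Huv; simpl.
        - pose proof (lam_pow_pos u). nra.
        - pose proof (lam_pow_pos m). nra. }
      destruct (Nat.lt_trichotomy a b) as [G|[G|G]]; [|easy|];
        apply K in G; lra. }
    destruct (edge_cases i) as [[n [E1 E2]]|[m [E1 E2]]]; rewrite E1, E2 in Ho, Hp;
    destruct (edge_cases j) as [[n' [E1' E2']]|[m' [E1' E2']]]; rewrite E1', E2' in Hp.
    + exfalso. pose proof (sg_lt_S n) as L.
      pose proof (proj1 (Hp _) (cseg_left _ _)) as A.
      pose proof (proj1 (Hp _) (cseg_right _ _)) as B.
      apply cseg_h in A; [|apply sg_lt_S]. apply cseg_h in B; [|apply sg_lt_S].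
      simpl in A, B. lra.
    + left. exists n. apply oseg_h in Ho; [|apply sg_lt_S].
      (* [A] and [B] put the translated ends of the first edge on the second; [C] and [D] pull the
         ends of the second back to the first. Together they match lengths and endpoints. *)
      assert (n = m' /\ fst q = fst p /\ snd q = sg (S (S (S n)))) as [_ [Q1 Q2]].
      { pose proof (sg_lt_S n) as L. pose proof (sg_lt_S m') as L'.
        pose proof (proj1 (Hp _) (cseg_left _ _)) as A.
        pose proof (proj1 (Hp _) (cseg_right _ _)) as B.
        apply cseg_v in A; [|easy]. apply cseg_v in B; [|easy].
        pose proof (proj2 (Hp (sg (S m') - (fst q - fst p), sg n))) as C.
        rewrite cseg_v, cseg_h in C by easy. simpl in C.
        pose proof (proj2 (Hp (sg (S (S m')) - (fst q - fst p), sg n))) as D.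
        rewrite cseg_v, cseg_h in D by easy. simpl in A, B, C, D.
        specialize (C ltac:(lra)). specialize (D ltac:(lra)).
        assert (n = m') by (apply Pow; lra). subst m'. repeat split; lra. }
      split; [exact Ho|]. now apply pt_eq.
    + right. exists m. apply oseg_v in Ho; [|apply sg_lt_S].
      assert (m = n' /\ snd q = snd p /\ fst q = sg m) as [_ [Q1 Q2]].
      { pose proof (sg_lt_S m) as L. pose proof (sg_lt_S n') as L'.
        pose proof (proj1 (Hp _) (cseg_left _ _)) as A.
        pose proof (proj1 (Hp _) (cseg_right _ _)) as B.
        apply cseg_h in A; [|easy]. apply cseg_h in B; [|easy].
        pose proof (proj2 (Hp (sg (S (S (S m))), sg (S n') - (snd q - snd p)))) as C.
        rewrite cseg_h, cseg_v in C by easy. simpl in C.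
        pose proof (proj2 (Hp (sg (S (S (S m))), sg (S (S n')) - (snd q - snd p)))) as D.
        rewrite cseg_h, cseg_v in D by easy. simpl in A, B, C, D.
        specialize (C ltac:(lra)). specialize (D ltac:(lra)).
        assert (m = n') by (apply Pow; lra). subst n'. repeat split; lra. }
      split; [exact Ho|]. now apply pt_eq.
    + exfalso. pose proof (sg_lt_S m) as L.
      pose proof (proj1 (Hp _) (cseg_left _ _)) as A.
      pose proof (proj1 (Hp _) (cseg_right _ _)) as B.
      apply cseg_v in A; [|apply sg_lt_S]. apply cseg_v in B; [|apply sg_lt_S].
      simpl in A, B. lra.
  - intros [[n [[H1 H2] ->]]|[m [[H1 H2] ->]]].
    + destruct (horizontal_edge n) as [i [E1 E2]], (vertical_edge n) as [j [F1 F2]].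
      exists i, j. unfold vU. rewrite E1, E2, F1, F2. split; [apply oseg_h; [apply sg_lt_S|auto]|].
      intros z. unfold swap. cbn [fst snd].
      rewrite !cseg_h by apply sg_lt_S. simpl. lra.
    + destruct (vertical_edge m) as [i [E1 E2]], (horizontal_edge m) as [j [F1 F2]].
      exists i, j. unfold vU. rewrite E1, E2, F1, F2.
      split; [apply oseg_v; [apply sg_lt_S|auto]|].
      intros z. unfold swap. cbn [fst snd]. rewrite !cseg_v by apply sg_lt_S. simpl in *. lra.
Qed.

(* The closed m-th horizontal cylinder, cut open, without its vertices. *)
Definition row (m : nat) (p : pt) : Prop :=
  sg (S m) <= snd p <= sg (S (S m)) /\ sg m <= fst p <= sg (S (S (S m))) /\
  (snd p = sg (S m) ->
     sg m < fst p < sg (S (S m)) \/ sg (S (S m)) < fst p < sg (S (S (S m)))) /\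
  (snd p = sg (S (S m)) ->
     sg m < fst p < sg (S m) \/ sg (S m) < fst p < sg (S (S (S m)))).

Lemma Omega_iff p :
  Omega lam p <->
  (exists n, sg (S n) <= fst p < sg (S (S n)) /\ sg n < snd p) /\
  (exists m, sg (S m) <= snd p < sg (S (S m)) /\ sg m < fst p).
Proof.
  unfold Omega.
  assert (E : forall n, s lam (Z.of_nat n) = sg (S (S n)) /\
    s lam (Z.of_nat n - 1) = sg (S n) /\ s lam (Z.of_nat n - 2) = sg n).
  { intros n. rewrite !lsum_def. repeat split; f_equal; lia. }
  split; intros [[n Hn] [m Hm]]; (split; [exists n|exists m]);
    destruct (E n) as [E1 [E2 E3]], (E m) as [F1 [F2 F3]].
  - now rewrite E1, E2, E3 in Hn.
  - now rewrite F1, F2, F3 in Hm.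
  - now rewrite E1, E2, E3.
  - now rewrite F1, F2, F3.
Qed.

Lemma Omega_row p : Omega lam p -> exists m, row m p.
Proof.
  intros H. apply Omega_iff in H as [[n [Hn1 Hn2]] [m [Hm1 Hm2]]].
  exists m. assert (n < S (S m))%nat by (apply sg_inv_lt; lra).
  sgl (S (S n)) (S (S (S m))).
  split; [lra|]. split; [lra|]. split; [|intros; lra].
  intros E1.
  destruct (Rtotal_order (fst p) (sg (S (S m)))) as [G|[G|G]]; [left; lra| |].
  - exfalso. assert (S (S m) < S (S n))%nat by (apply sg_inv_lt; lra).
    assert (n = S m) by lia. subst n. lra.
  - right. split; [lra|]. destruct (Nat.eq_dec n (S m)) as [->|]; [lra|].
    sgl (S (S n)) (S (S m)). lra.
Qed.

Lemma Omega_intro p n m :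
  sg (S n) <= fst p < sg (S (S n)) -> sg n < snd p ->
  sg (S m) <= snd p < sg (S (S m)) -> sg m < fst p -> Omega lam p.
Proof. intros. apply Omega_iff. split; [exists n|exists m]; auto. Qed.

Lemma row_Dom m p : row m p -> Dom p.
Proof.
  intros [H1 [H2 [H3 H4]]].
  destruct (Req_dec (snd p) (sg (S m))) as [E|E].
  - destruct (H3 E) as [G|G].
    + destruct m as [|m].
      * right; left. apply oseg_L. left. exists 0%nat. unfold lower_edge.
        rewrite sg_0, sg_1 in *. lra.
      * left. sgm (S m) (S (S m)). sgl m (S m). sgm (S (S m)) (S (S (S m))).
        destruct (Rlt_dec (fst p) (sg (S (S m)))).
        { apply (Omega_intro p m (S m)); lra. }
        { apply (Omega_intro p (S m) (S m)); lra. }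
    + right; left. apply oseg_L. left. exists (S m). unfold lower_edge. lra.
  - destruct (Req_dec (snd p) (sg (S (S m)))) as [E'|E'].
    + destruct (H4 E') as [G|G].
      * right; right. apply oseg_U. right. destruct m as [|m]; [rewrite sg_0, sg_1 in *; lra|].
        exists m. unfold upper_edge. lra.
      * left. sgm (S m) (S (S m)). sgl m (S m). sgm (S (S m)) (S (S (S m))).
        destruct (Rlt_dec (fst p) (sg (S (S m)))).
        { apply (Omega_intro p m (S m)); lra. }
        { apply (Omega_intro p (S m) (S m)); lra. }
    + assert (sg (S m) < snd p < sg (S (S m))) by (split; apply Rnot_le_lt; intro; [apply E|apply E']; lra).
      destruct (Req_dec (fst p) (sg m)) as [G|G].
      { right; right. apply oseg_U. left. exists m. unfold lower_edge. simpl. lra. }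
      destruct (Req_dec (fst p) (sg (S (S (S m))))) as [G'|G'].
      { right; left. apply oseg_L. right. exists m. unfold upper_edge. simpl. lra. }
      assert (sg m < fst p < sg (S (S (S m)))) by (split; apply Rnot_le_lt; intro; [apply G|apply G']; lra).
      left. sgl m (S m). sgm (S m) (S (S m)).
      destruct (Rlt_dec (fst p) (sg (S m))) as [K|K].
      { destruct m as [|m]; [rewrite sg_0, sg_1 in *; lra|].
        sgl m (S (S m)). apply (Omega_intro p m (S m)); lra. }
      destruct (Rlt_dec (fst p) (sg (S (S m)))) as [K'|K'].
      { apply (Omega_intro p m m); lra. }
      apply (Omega_intro p (S m) m); lra.
Qed.

Lemma Dom_row p : Dom p -> exists m, row m p.
Proof.
  intros [H|[H|H]]; [now apply Omega_row| |].
  - apply oseg_L in H as [[n [H1 H2]]|[m [H1 H2]]].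
    + destruct n as [|n].
      * exists 0%nat. sgm 0%nat 2%nat. sgm 2%nat 3%nat. unfold row. rewrite sg_0, sg_1 in *. lra.
      * exists n. sgm (S n) (S (S n)). sgl n (S n). unfold row. lra.
    + exists m. simpl in *. sgm m (S (S (S m))). unfold row. lra.
  - apply oseg_U in H as [[m [H1 H2]]|[n [H1 H2]]].
    + exists m. simpl in *. sgm m (S (S (S m))). unfold row. lra.
    + exists (S n). sgm (S (S n)) (S (S (S n))).
      sgm (S (S (S n))) (S (S (S (S n)))). unfold row. lra.
Qed.

Lemma Dom_swap p : Dom (swap p) <-> Dom p.
Proof.
  assert (K : forall p, Dom p -> Dom (swap p)).
  { clear p. intros p [[H1 H2]|[[i H]|[i H]]].
    - left. split; auto.
    - right; right. exists i. now apply oseg_swap.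
    - right; left. exists i. unfold vU in H. now rewrite <- oseg_swap, swap_swap. }
  split; [|apply K]. intros H. rewrite <- (swap_swap p). auto.
Qed.

Lemma Dom_in_row m p :
  Dom p -> sg (S m) < snd p < sg (S (S m)) -> sg m <= fst p <= sg (S (S (S m))).
Proof.
  intros H1 H2. destruct (Dom_row p H1) as [i [R1 [R2 _]]].
  rewrite (interval_unique m i (snd p)) by lra. lra.
Qed.

Lemma Dom_in_col m p :
  Dom p -> sg (S m) < fst p < sg (S (S m)) -> sg m <= snd p <= sg (S (S (S m))).
Proof. intros H1 H2. apply (Dom_in_row m (swap p)); [now apply Dom_swap|easy]. Qed.

Lemma lower_edge_Dom n p : lower_edge n p -> Dom p.
Proof. intros H. right; left. apply oseg_L. eauto. Qed.

Lemma upper_edge_Dom n p : upper_edge n p -> Dom p.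
Proof. intros H. right; right. apply oseg_U. eauto. Qed.

Lemma glue_swap p q : glue p q -> glue (swap q) (swap p).
Proof.
  rewrite !glue_iff. intros [[n [[H1 H2] ->]]|[m [[H1 H2] ->]]].
  - right. exists n. split; [split; auto|]. apply pt_eq; simpl; auto.
  - left. exists m. split; [split; auto|]. apply pt_eq; simpl in *; auto.
Qed.
End Domain.

Ltac unfold_edges := unfold lower_edge, upper_edge in *.
Ltac unfold_row := unfold row.

(** * The translation surface *)

Definition small (e : R) (w : pt) : Prop := Rabs (fst w) < e /\ Rabs (snd w) < e.

Lemma small_le e e' w : e <= e' -> small e w -> small e' w.
Proof. unfold small. lra. Qed.

Lemma small_iff e w : small e w <-> - e < fst w < e /\ - e < snd w < e.
Proof.
  unfold small. split; intros [H1 H2]; (split; [clear H2|clear H1]).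
  - apply Rabs_def2 in H1. lra.
  - apply Rabs_def2 in H2. lra.
  - now apply Rabs_def1.
  - now apply Rabs_def1.
Qed.

Lemma small_swap e w : small e w -> small e (swap w).
Proof. unfold small. simpl. tauto. Qed.

Ltac two_small e1 e2 :=
  exists (Rmin e1 e2);
  pose proof (Rmin_l e1 e2); pose proof (Rmin_r e1 e2);
  split; [apply Rmin_glb_lt; try assumption; try lra|].

Section Surface.
Context {lam : R} {Hlam : ladder_ratio lam}.
Local Notation sg := (lsum lam).
Local Notation Dom := (Dom lam).
Local Notation glue := (glue lam).
Local Notation eqv := (eqv lam).
Local Notation lower_edge := (@lower_edge lam).
Local Notation upper_edge := (@upper_edge lam).

Lemma sg_not_between j n : ~ sg (S n) < sg j < sg (S (S n)).
Proof. intros [H1 H2]. apply sg_inv_lt in H1, H2. lia. Qed.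

(** The sequence accumulates only at its limit, which it never attains. Values rather than indices
    are compared because [sg 0 = sg 1]. *)
Lemma sg_isolated j : exists e, 0 < e /\ forall n, Rabs (sg n - sg j) < e -> sg n = sg j.
Proof.
  destruct j as [|[|j]].
  - exists 1. split; [lra|]. intros n H. destruct n as [|[|n]]; rewrite ?sg_0, ?sg_1 in *; try easy.
    sgl 2%nat (S (S n)). rewrite sg_2 in *. apply Rabs_def2 in H. lra.
  - exists 1. split; [lra|]. intros n H. destruct n as [|[|n]]; rewrite ?sg_0, ?sg_1 in *; try easy.
    sgl 2%nat (S (S n)). rewrite sg_2 in *. apply Rabs_def2 in H. lra.
  - two_small (sg (S (S (S j))) - sg (S (S j))) (sg (S (S j)) - sg (S j)).
    + sgm (S (S j)) (S (S (S j))). lra.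
    + sgm (S j) (S (S j)). lra.
    + intros n G. apply Rabs_def2 in G.
      assert (n < S (S (S j)))%nat by (apply sg_inv_lt; lra).
      assert (S j < n)%nat by (apply sg_inv_lt; lra).
      now replace n with (S (S j)) by lia.
Qed.

Lemma sg_eq_inv i j : sg i = sg (S (S j)) -> i = S (S j).
Proof.
  intros H. destruct (Nat.lt_trichotomy i (S (S j))) as [G|[G|G]]; [|easy|];
    apply (sg_lt (lam := lam)) in G; lra || lia.
Qed.

Definition is_L p := (exists n, lower_edge n p) \/ (exists m, upper_edge m (swap p)).

Lemma glue_is_L p q : glue p q -> is_L p.
Proof. rewrite glue_iff. intros [[n [H _]]|[m [H _]]]; [left|right]; eauto. Qed.

Lemma glue_is_U p q : glue p q -> is_L (swap q).
Proof. intros H. apply glue_swap in H. now apply glue_is_L in H. Qed.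

(** Consequently gluings never chain: [eqv] is transitive and a class has at most two points. *)
Lemma L_U_disjoint p : is_L p -> is_L (swap p) -> False.
Proof.
  unfold is_L. rewrite swap_swap. unfold_edges. simpl.
  intros [[n [H1 H2]]|[n [H1 H2]]] [[m [G1 G2]]|[m [G1 G2]]].
  - rewrite G2 in H1. now apply sg_not_between in H1.
  - assert (n = m) by (apply (interval_unique (lam := lam) n m (fst p)); lra). subst m.
    sgm n (S (S (S n))). lra.
  - assert (n = m) by (apply (interval_unique (lam := lam) n m (snd p)); lra). subst m.
    sgm n (S (S (S n))). lra.
  - rewrite G2 in H1. now apply sg_not_between in H1.
Qed.

Lemma glue_fun p q q' : glue p q -> glue p q' -> q = q'.
Proof.
  rewrite !glue_iff. unfold_edges. simpl.
  intros [[n [[H1 H2] ->]]|[n [[H1 H2] ->]]] [[m [[G1 G2] ->]]|[m [[G1 G2] ->]]].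
  - assert (n = m) by (apply (interval_unique (lam := lam) n m (fst p)); lra). now subst m.
  - exfalso. rewrite G2 in H1. now apply sg_not_between in H1.
  - exfalso. rewrite G2 in H1. now apply sg_not_between in H1.
  - assert (n = m) by (apply (interval_unique (lam := lam) n m (snd p)); lra). now subst m.
Qed.

Lemma glue_inj p p' q : glue p q -> glue p' q -> p = p'.
Proof.
  intros H1 H2. apply glue_swap in H1, H2.
  rewrite <- (swap_swap p), <- (swap_swap p'). f_equal. eapply glue_fun; eauto.
Qed.

Lemma glue_Dom p q : glue p q -> Dom p /\ Dom q.
Proof.
  assert (K : forall p q, glue p q -> Dom p).
  { clear p q. intros p q H. apply glue_is_L in H as [[n H]|[m H]].
    - eapply lower_edge_Dom; eauto.
    - apply Dom_swap. eapply upper_edge_Dom; eauto. }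
  intros H. split; [eapply K; eauto|]. apply glue_swap, K in H. now apply Dom_swap.
Qed.

Lemma eqv_refl p : eqv p p.
Proof. now left. Qed.

Lemma eqv_sym p q : eqv p q -> eqv q p.
Proof. unfold Defs.eqv. intuition. Qed.

Lemma eqv_trans p q r : eqv p q -> eqv q r -> eqv p r.
Proof.
  intros [->|[H|H]]; [easy| |]; intros [<-|[G|G]].
  - now right; left.
  - exfalso. apply glue_is_U in H. apply glue_is_L in G. eapply L_U_disjoint; eauto.
  - left. eapply glue_inj; eauto.
  - now right; right.
  - left. eapply glue_fun; eauto.
  - exfalso. apply glue_is_L in H. apply glue_is_U in G. eapply L_U_disjoint; eauto.
Qed.

Lemma eqv_Dom p q : eqv p q -> Dom p -> Dom q.
Proof. intros [->|[H|H]]; [easy| |]; apply glue_Dom in H; tauto. Qed.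

Lemma eqv_swap p q : eqv p q -> eqv (swap p) (swap q).
Proof.
  intros [->|[H|H]]; [left; easy| |]; apply glue_swap in H; [right; right|right; left]; easy.
Qed.

Lemma rep_Dom (x : X lam) p : rep x p -> Dom p.
Proof.
  destruct x as [C [p0 [H ->]]]. unfold rep. simpl. intros G. eapply eqv_Dom; eauto.
Qed.

Lemma rep_eqv (x : X lam) p q : rep x p -> (rep x q <-> eqv p q).
Proof.
  destruct x as [C [p0 [H ->]]]. unfold rep. simpl. intros G. split; intros K.
  - eapply eqv_trans; [apply eqv_sym|]; eauto.
  - eapply eqv_trans; eauto.
Qed.

Lemma rep_unique (x y : X lam) p : rep x p -> rep y p -> x = y.
Proof.
  intros Hx Hy.
  assert (E : proj1_sig x = proj1_sig y).
  { extensionality q. apply propositional_extensionality.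
    change (rep x q <-> rep y q). now rewrite (rep_eqv x p q), (rep_eqv y p q). }
  destruct x as [C HC], y as [C' HC']. simpl in E. subst C'. f_equal. apply proof_irrelevance.
Qed.

Lemma rep_exists (x : X lam) : exists p, rep x p.
Proof.
  destruct x as [C [p [H ->]]]. exists p. unfold rep. simpl. apply eqv_refl.
Qed.

Lemma cl_exists p : Dom p -> exists x : X lam, rep x p.
Proof.
  intros H. exists (exist _ (eqv p) (ex_intro _ p (conj H eq_refl))). unfold rep. simpl. apply eqv_refl.
Qed.

Lemma rep_cases (x : X lam) :
  (exists a, rep x a /\ forall r, rep x r -> r = a) \/
  (exists a b, glue a b /\ rep x a /\ rep x b /\ forall r, rep x r -> r = a \/ r = b).
Proof.
  destruct (rep_exists x) as [p Hp].
  destruct (classic (exists q, glue p q \/ glue q p)) as [[q [H|H]]|N].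
  - right. exists p, q. repeat split; auto.
    + rewrite (rep_eqv x p q Hp). right; now left.
    + intros r Hr. rewrite (rep_eqv x p r Hp) in Hr. destruct Hr as [->|[G|G]]; auto.
      * right. eapply glue_fun; eauto.
      * exfalso. apply glue_is_L in H. apply glue_is_U in G. eapply L_U_disjoint; eauto.
  - right. exists q, p. repeat split; auto.
    + rewrite (rep_eqv x p q Hp). right; now right.
    + intros r Hr. rewrite (rep_eqv x p r Hp) in Hr. destruct Hr as [->|[G|G]]; auto.
      * exfalso. apply glue_is_U in H. apply glue_is_L in G. eapply L_U_disjoint; eauto.
      * left. eapply glue_inj; eauto.
  - left. exists p. split; auto. intros r Hr. rewrite (rep_eqv x p r Hp) in Hr.
    destruct Hr as [->|G]; auto. exfalso. eauto.
Qed.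

(* [disp x w y]: y is x displaced by w in the polygon; a local notion, meaningful for small w. *)
Definition disp (x : X lam) (w : pt) (y : X lam) : Prop :=
  exists r, rep x r /\ rep y (padd r w).

(** On two glued edges the polygon lies on opposite sides. Both displaced points can stay in it only
    if the displacement runs along the edge, and then they are glued again. *)
Lemma glue_local a b : glue a b -> exists e, 0 < e /\ forall w, small e w ->
  Dom (padd a w) -> Dom (padd b w) -> glue (padd a w) (padd b w).
Proof.
  assert (K : forall n a, lower_edge n a -> exists e, 0 < e /\ forall w, small e w ->
    Dom (padd a w) -> Dom (padd (fst a, sg (S (S (S n)))) w) ->
    lower_edge n (padd a w) /\ snd w = 0).
  { clear a b. intros n a [H1 H2].
    two_small (fst a - sg (S n)) (sg (S (S n)) - fst a).
    intros w Hw D1 D2. apply small_iff in Hw.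
    pose proof (Rmin_l (fst a - sg (S n)) (sg (S (S n)) - fst a)).
    pose proof (Rmin_r (fst a - sg (S n)) (sg (S (S n)) - fst a)).
    apply (Dom_in_col n) in D1; [|simpl; lra]. apply (Dom_in_col n) in D2; [|simpl; lra].
    simpl in *. unfold_edges. simpl. lra. }
  intros H. rewrite glue_iff in H. destruct H as [[n [H ->]]|[m [H ->]]].
  - destruct (K n a H) as [e [He L]]. exists e. split; [easy|]. intros w Hw D1 D2.
    destruct (L w Hw D1 D2) as [L1 L2]. apply glue_iff. left. exists n. split; [easy|].
    apply pt_eq; simpl; lra.
  - destruct (K m (swap (sg m, snd a))) as [e [He L]].
    { destruct H. split; simpl in *; auto. }
    exists e. split; [easy|]. intros w Hw D1 D2. simpl in L.
    destruct (L (swap w)) as [L1 L2].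
    + now apply small_swap.
    + apply Dom_swap. replace (swap (padd (snd a, sg m) (swap w))) with (padd (sg m, snd a) w); auto.
    + apply Dom_swap. destruct H as [H1 H2]. simpl in H1, H2. rewrite <- H2.
      replace (swap (padd (snd a, fst a) (swap w))) with (padd a w); auto.
    + apply glue_iff. right. exists m. destruct L1 as [L1 L3], H as [H H'].
      unfold_edges. simpl in *.
      split; [lra|]. apply pt_eq; simpl; lra.
Qed.

Lemma disp_fun_local (x : X lam) : exists e, 0 < e /\ forall w, small e w ->
  forall y y', disp x w y -> disp x w y' -> y = y'.
Proof.
  destruct (rep_cases x) as [[a [Ha Ua]]|[a [b [G [Ha [Hb U]]]]]].
  - exists 1. split; [lra|]. intros w _ y y' [r [H1 H2]] [r' [H1' H2']].
    rewrite (Ua _ H1) in H2. rewrite (Ua _ H1') in H2'. eapply rep_unique; eauto.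
  - destruct (glue_local a b G) as [e [He L]]. exists e. split; [easy|].
    assert (K : forall w (y y' : X lam), small e w -> rep y (padd a w) -> rep y' (padd b w) -> y = y').
    { intros w y y' Hw H1 H2. apply rep_unique with (padd b w); auto.
      rewrite (rep_eqv y _ _ H1). right; left. apply L; auto; eapply rep_Dom; eauto. }
    intros w Hw y y' [r [H1 H2]] [r' [H1' H2']].
    destruct (U _ H1) as [->| ->], (U _ H1') as [->| ->].
    + eapply rep_unique; eauto.
    + eapply K; eauto.
    + symmetry. eapply K; eauto.
    + eapply rep_unique; eauto.
Qed.

(** The ends of an edge are vertices, hence outside [Dom], so each edge is closed in [Dom]; one
    radius serves all edges because their heights are isolated. *)
Lemma edge_local r : Dom r -> exists e, 0 < e /\ forall w, small e w -> forall n,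
  (lower_edge n (padd r w) -> lower_edge n r) /\ (upper_edge n (padd r w) -> upper_edge n r).
Proof.
  intros H. apply Dom_row in H as [m [H1 [H2 [H3 H4]]]].
  (* [(a, b)] will be the vertex-free interval around [r] on the boundary line of height [sg j]; [P]
     and [Q] say that an edge of that height meeting the interval fills it. *)
  assert (K : forall j a b, snd r = sg j -> a < fst r < b ->
    (forall n x, a < x < b -> sg (S n) < x < sg (S (S n)) -> sg n = sg j -> a = sg (S n) /\ b = sg (S (S n))) ->
    (forall n x, a < x < b -> sg (S n) < x < sg (S (S n)) -> sg (S (S (S n))) = sg j -> a = sg (S n) /\ b = sg (S (S n))) ->
    exists e, 0 < e /\ forall w, small e w -> forall n,
    (lower_edge n (padd r w) -> lower_edge n r) /\ (upper_edge n (padd r w) -> upper_edge n r)).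
  { intros j a b E Hab P Q. destruct (sg_isolated j) as [d [Hd I]].
    exists (Rmin d (Rmin (fst r - a) (b - fst r))).
    split; [repeat apply Rmin_glb_lt; lra|].
    intros w Hw n. apply small_iff in Hw.
    pose proof (Rmin_l d (Rmin (fst r - a) (b - fst r))).
    pose proof (Rmin_r d (Rmin (fst r - a) (b - fst r))).
    pose proof (Rmin_l (fst r - a) (b - fst r)).
    pose proof (Rmin_r (fst r - a) (b - fst r)).
    unfold_edges. simpl. split; intros [G1 G2].
    - assert (J : sg n = sg j) by (apply I, Rabs_def1; lra).
      destruct (P n (fst r + fst w)); lra.
    - assert (J : sg (S (S (S n))) = sg j) by (apply I, Rabs_def1; lra).
      destruct (Q n (fst r + fst w)); lra. }
  assert (O : forall n a b x, sg a < x < sg b -> sg (S n) < x < sg (S (S n)) ->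
     (a < S (S n))%nat /\ (S n < b)%nat).
  { intros n a b x G1 G2. split; apply (sg_inv_lt (lam := lam)); lra. }
  destruct (Req_dec (snd r) (sg (S m))) as [E|E]; [|destruct (Req_dec (snd r) (sg (S (S m)))) as [E'|E']].
  - destruct (H3 E) as [G|G]; (eapply (K (S m)); [easy|apply G| |]);
      intros n x G1 G2 G3; pose proof (O _ _ _ _ G1 G2).
    + destruct m as [|m]; [|apply sg_eq_inv in G3; lia].
      assert (n = 0)%nat by lia. subst n. rewrite sg_0, sg_1. auto.
    + destruct m as [|m]; apply (sg_eq_inv (S (S (S n))) m) in G3 || (sgl 3%nat (S (S (S n))); rewrite sg_1, sg_3 in *; pose proof (lam_pos (lam := lam)); lra); lia.
    + destruct m as [|m]; [|apply sg_eq_inv in G3; subst n; auto].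
      assert (n = 1)%nat by lia. now subst n.
    + destruct m as [|m]; apply (sg_eq_inv (S (S (S n))) m) in G3 || (sgl 3%nat (S (S (S n))); rewrite sg_1, sg_3 in *; pose proof (lam_pos (lam := lam)); lra); lia.
  - destruct (H4 E') as [G|G]; (eapply (K (S (S m))); [easy|apply G| |]);
      intros n x G1 G2 G3; pose proof (O _ _ _ _ G1 G2); apply sg_eq_inv in G3; try lia.
    assert (m = S n) by lia. now subst m.
  - two_small (snd r - sg (S m)) (sg (S (S m)) - snd r).
    intros w Hw n. apply small_iff in Hw.
    pose proof (Rmin_l (snd r - sg (S m)) (sg (S (S m)) - snd r)).
    pose proof (Rmin_r (snd r - sg (S m)) (sg (S (S m)) - snd r)).
    unfold_edges. simpl. split; intros [G1 G2]; exfalso.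
    + apply (sg_not_between n m). lra.
    + apply (sg_not_between (S (S (S n))) m). lra.
Qed.

Lemma eqv_closed r r' : Dom r -> Dom r' -> exists e, 0 < e /\ forall w, small e w ->
  eqv (padd r w) (padd r' w) -> eqv r r'.
Proof.
  assert (K : forall r r', Dom r -> exists e, 0 < e /\ forall w, small e w ->
    glue (padd r w) (padd r' w) -> glue r r').
  { clear r r'. intros r r' H.
    destruct (edge_local r H) as [e1 [He1 L1]].
    destruct (edge_local (swap r)) as [e2 [He2 L2]]; [now apply Dom_swap|].
    two_small e1 e2. intros w Hw. rewrite !glue_iff.
    intros [[n [G1 G2]]|[n [G1 G2]]].
    - left. exists n. apply L1 in G1 as G3; [|eapply small_le; [apply Rmin_l|eauto]].
      split; [easy|]. destruct G1 as [_ G1], G3 as [_ G3]. apply (f_equal fst) in G2 as G4.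
      apply (f_equal snd) in G2. simpl in *. apply pt_eq; simpl; lra.
    - right. exists n.
      rewrite swap_padd in G1. apply L2 in G1 as G3;
        [|apply small_swap; eapply small_le; [apply Rmin_r|eauto]].
      split; [easy|]. destruct G1 as [_ G1], G3 as [_ G3]. apply (f_equal fst) in G2 as G4.
      apply (f_equal snd) in G2. simpl in *. apply pt_eq; simpl; lra. }
  intros H H'. destruct (K r r' H) as [e1 [He1 L1]], (K r' r H') as [e2 [He2 L2]].
  two_small e1 e2. intros w Hw [G|[G|G]].
  - left. apply (f_equal fst) in G as G1. apply (f_equal snd) in G. simpl in *.
    apply pt_eq; lra.
  - right; left. apply (L1 w); [eapply small_le; [apply Rmin_l|eauto]|auto].
  - right; right. apply (L2 w); [eapply small_le; [apply Rmin_r|eauto]|auto].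
Qed.

Lemma rep_two (x : X lam) : exists a b, rep x a /\ rep x b /\ forall r, rep x r -> r = a \/ r = b.
Proof.
  destruct (rep_cases x) as [[a [Ha Ua]]|[a [b [G [Ha [Hb U]]]]]].
  - exists a, a. repeat split; auto.
  - exists a, b. repeat split; auto.
Qed.

(** The Hausdorff property, in the form needed to pass to the limit along two paths that agree up to
    a given time. *)
Lemma disp_separated (x x' : X lam) : exists e, 0 < e /\ forall w, small e w ->
  forall y, disp x w y -> disp x' w y -> x = x'.
Proof.
  assert (K : forall a a', rep x a -> rep x' a' -> exists e, 0 < e /\ forall w, small e w ->
    forall y : X lam, rep y (padd a w) -> rep y (padd a' w) -> x = x').
  { intros a a' Ha Ha'.
    destruct (eqv_closed a a' (rep_Dom _ _ Ha) (rep_Dom _ _ Ha')) as [e [He L]].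
    exists e. split; [easy|]. intros w Hw y Hy Hy'.
    apply rep_unique with a'; auto. rewrite (rep_eqv x a a'); auto.
    apply (L w); auto. now rewrite <- (rep_eqv y). }
  destruct (rep_two x) as [a [b [Ha [Hb U]]]], (rep_two x') as [a' [b' [Ha' [Hb' U']]]].
  destruct (K a a' Ha Ha') as [e1 [He1 L1]], (K a b' Ha Hb') as [e2 [He2 L2]],
    (K b a' Hb Ha') as [e3 [He3 L3]], (K b b' Hb Hb') as [e4 [He4 L4]].
  exists (Rmin (Rmin e1 e2) (Rmin e3 e4)). split; [repeat apply Rmin_glb_lt; auto|].
  intros w Hw y [r [H1 H2]] [r' [H1' H2']].
  pose proof (Rmin_l (Rmin e1 e2) (Rmin e3 e4)). pose proof (Rmin_r (Rmin e1 e2) (Rmin e3 e4)).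
  pose proof (Rmin_l e1 e2). pose proof (Rmin_r e1 e2).
  pose proof (Rmin_l e3 e4). pose proof (Rmin_r e3 e4).
  destruct (U _ H1) as [->| ->], (U' _ H1') as [->| ->];
    [eapply (L1 w)|eapply (L2 w)|eapply (L3 w)|eapply (L4 w)]; eauto;
    apply small_le with (2 := Hw); lra.
Qed.
End Surface.

(** * Horizontal cylinders *)

Ltac three_small e1 e2 e3 :=
  exists (Rmin e1 (Rmin e2 e3));
  pose proof (Rmin_l e1 (Rmin e2 e3)); pose proof (Rmin_r e1 (Rmin e2 e3));
  pose proof (Rmin_l e2 e3); pose proof (Rmin_r e2 e3);
  split; [repeat apply Rmin_glb_lt; try assumption; try lra|].

Lemma shift_into a x c : 0 < c -> exists z, a <= x + IZR z * c < a + c.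
Proof.
  intros Hc. exists (1 - up ((x - a) / c))%Z. rewrite minus_IZR.
  destruct (archimed ((x - a) / c)) as [H1 H2].
  set (u := IZR (up ((x - a) / c))) in *.
  assert (E : x - a = (x - a) / c * c) by (field; lra).
  assert ((x - a) / c * c < u * c) by (apply Rmult_lt_compat_r; lra).
  assert ((u - (x - a) / c) * c <= 1 * c) by (apply Rmult_le_compat_r; lra).
  lra.
Qed.

Lemma fst_padd p q : fst (padd p q) = fst p + fst q.
Proof. reflexivity. Qed.

Section Cylinders.
Context {lam : R} {Hlam : ladder_ratio lam}.
Local Notation sg := (lsum lam).
Local Notation circ := (circum lam).
Local Notation glue := (glue lam).
Local Notation row := (@row lam).

(* The universal cover of the closed m-th horizontal cylinder, with deck translation [circ m]. *)
Definition cyl (m : nat) (p : pt) (x : X lam) : Prop :=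
  exists z, row m (fst p + IZR z * circ m, snd p) /\ rep x (fst p + IZR z * circ m, snd p).

Lemma cyl_range m p x : cyl m p x -> sg (S m) <= snd p <= sg (S (S m)).
Proof. intros [z [[H _] _]]. exact H. Qed.

Lemma cyl_row m p x : row m p -> rep x p -> cyl m p x.
Proof.
  intros H1 H2. exists 0%Z.
  replace (fst p + IZR 0 * circ m, snd p) with p; auto. apply pt_eq; simpl; lra.
Qed.

Lemma cyl_shift m p z x : cyl m p x -> cyl m (fst p + IZR z * circ m, snd p) x.
Proof.
  intros [z' [H1 H2]]. exists (z' - z)%Z. simpl. rewrite minus_IZR.
  replace (fst p + IZR z * circ m + (IZR z' - IZR z) * circ m)
    with (fst p + IZR z' * circ m) by ring. auto.
Qed.

(** A row is one period wide, so two translates of [p] in it differ by at most one period; if they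
    differ by one, they are its left and right ends, which are glued. *)
Lemma cyl_fun m p x x' : cyl m p x -> cyl m p x' -> x = x'.
Proof.
  pose proof (circ_pos (lam := lam) m) as Hc.
  assert (K : forall z (x x' : X lam), row m (fst p + IZR z * circ m, snd p) ->
    row m (fst p + IZR (z + 1) * circ m, snd p) ->
    rep x (fst p + IZR z * circ m, snd p) ->
    rep x' (fst p + IZR (z + 1) * circ m, snd p) -> x = x').
  { clear x x'. intros z x x'. rewrite plus_IZR.
    intros [A1 [A2 [A3 A4]]] [B1 [B2 [B3 B4]]] R1 R2. simpl in *. unfold circum in *.
    assert (E1 : fst p + IZR z * (sg (S (S (S m))) - sg m) = sg m) by lra.
    assert (E2 : fst p + (IZR z + 1) * (sg (S (S (S m))) - sg m) = sg (S (S (S m)))) by lra.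
    rewrite E1, E2 in *.
    apply rep_unique with (sg m, snd p); auto.
    rewrite (rep_eqv x' _ _ R2). right; left. apply glue_iff. right. exists m.
    unfold_edges. simpl. repeat split; auto.
    - destruct (proj1 A1) as [?|E]; auto. specialize (A3 (eq_sym E)). lra.
    - destruct (proj2 A1) as [?|E]; auto. specialize (A4 E). lra. }
  intros [z [A R1]] [z' [B R2]].
  assert (D : (z' = z \/ z' = z + 1 \/ z = z' + 1)%Z).
  { destruct A as [_ [A _]], B as [_ [B _]]. simpl in *. unfold circum in *.
    set (c := sg (S (S (S m))) - sg m) in *.
    replace (sg (S (S (S m)))) with (sg m + c) in * by (unfold c; lra). clearbody c.
    assert (H : IZR z' - IZR z < 2).
    { apply Rnot_le_lt. intros L. apply (Rmult_le_compat_r c) in L; lra. }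
    assert (H0 : IZR z - IZR z' < 2).
    { apply Rnot_le_lt. intros L. apply (Rmult_le_compat_r c) in L; lra. }
    rewrite <- minus_IZR in *. apply lt_IZR in H, H0. lia. }
  destruct D as [-> | [-> | ->]].
  - eapply rep_unique; eauto.
  - eapply (K z); eauto.
  - symmetry. eapply (K z'); eauto.
Qed.

Lemma cyl_exists m p : sg (S m) < snd p < sg (S (S m)) -> exists x, cyl m p x.
Proof.
  intros H. destruct (shift_into (sg m) (fst p) (circ m)) as [z Hz]; [apply circ_pos|].
  assert (G : row m (fst p + IZR z * circ m, snd p)).
  { unfold circum in *. unfold_row. simpl. repeat split; try lra; intros; lra. }
  destruct (cl_exists _ (row_Dom _ _ G)) as [x Hx]. exists x, z. auto.
Qed.

(** Points of one row are glued only across its vertical sides, since the two members of a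
    horizontal pair border different rows. Applied to the two ends of a closed path, this shows the
    multiple of [circ m]. *)
Lemma cyl_inj m p q x : cyl m p x -> cyl m q x ->
  snd q = snd p /\ exists z, fst q = fst p + IZR z * circ m.
Proof.
  intros [z1 [A R1]] [z2 [B R2]]. rewrite (rep_eqv x _ _ R1) in R2.
  assert (K : forall p q, row m p -> row m q -> glue p q -> snd q = snd p /\ fst q = fst p - circ m).
  { clear - Hlam. intros p q [A _] [B _] G. apply glue_iff in G as [[j [[G1 G2] ->]]|[j [[G1 G2] ->]]].
    - exfalso. simpl in *.
      assert (S j < S (S m))%nat by (apply (sg_inv_lt (lam := lam)); sgm (S j) (S (S (S j))); sgm (S (S j)) (S (S (S j))); lra).
      destruct m as [|m].
      + assert (j = 0)%nat by lia. subst j. sgm 2%nat 3%nat. lra.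
      + sgm j (S (S m)). lra.
    - simpl in *. assert (j = m) by (apply (interval_unique (lam := lam) j m (snd p)); lra).
      subst j. unfold circum. split; lra. }
  destruct R2 as [E|[E|E]].
  - apply (f_equal fst) in E as E1. apply (f_equal snd) in E. simpl in *. split; [easy|].
    exists (z1 - z2)%Z. rewrite minus_IZR. lra.
  - apply K in E as [E1 E2]; auto. simpl in *. split; [easy|].
    exists (z1 - z2 - 1)%Z. rewrite !minus_IZR. lra.
  - apply K in E as [E1 E2]; auto. simpl in *. split; [easy|].
    exists (z1 - z2 + 1)%Z. rewrite plus_IZR, minus_IZR. lra.
Qed.

Lemma cyl_interior_unique m n p q x :
  cyl m p x -> sg (S m) < snd p < sg (S (S m)) -> cyl n q x -> n = m.
Proof.
  intros [z1 [A R1]] H [z2 [B R2]]. rewrite (rep_eqv x _ _ R1) in R2.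
  destruct B as [B _]. symmetry. apply (interval_unique (lam := lam) m n (snd p)); auto.
  destruct R2 as [E|[E|E]].
  - apply (f_equal snd) in E. simpl in *. lra.
  - apply glue_iff in E as [[j [[G1 G2] E]]|[j [[G1 G2] E]]]; apply (f_equal snd) in E; simpl in *.
    + exfalso. apply (sg_not_between (lam := lam) j m). lra.
    + lra.
  - apply glue_iff in E as [[j [[G1 G2] E]]|[j [[G1 G2] E]]]; apply (f_equal snd) in E; simpl in *.
    + exfalso. apply (sg_not_between (lam := lam) (S (S (S j))) m). lra.
    + lra.
Qed.

Lemma cyl_open m p x : cyl m p x -> exists e, 0 < e /\ forall w, small e w ->
  sg (S m) <= snd p + snd w <= sg (S (S m)) ->
  exists y, cyl m (padd p w) y /\ disp x w y.
Proof.
  intros [z [A R1]].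
  set (p' := (fst p + IZR z * circ m, snd p)) in *.
  assert (Ep : snd p = snd p') by reflexivity. rewrite Ep. clear Ep.
  assert (K : forall w, row m (padd p' w) -> exists y, cyl m (padd p w) y /\ disp x w y).
  { intros w H. destruct (cl_exists _ (row_Dom _ _ H)) as [y Hy]. exists y. split.
    - exists z. replace (fst (padd p w) + IZR z * circ m, snd (padd p w)) with (padd p' w); auto.
      unfold p'. apply pt_eq; simpl; lra.
    - exists p'. auto. }
  pose proof (sg_lt_S (lam := lam) m) as Hm.
  destruct A as [A1 [A2 [A3 A4]]].
  destruct (Req_dec (snd p') (sg (S m))) as [E|E]; [|destruct (Req_dec (snd p') (sg (S (S m)))) as [E'|E']].
  - destruct (A3 E) as [G|G].
    + three_small (fst p' - sg m) (sg (S (S m)) - fst p') (sg (S (S m)) - sg (S m)).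
      intros w Hw Hs. apply small_iff in Hw. apply K. unfold_row. cbn [padd fst snd].
      split; [lra|]. sgm (S (S m)) (S (S (S m))). split; [lra|].
      split; intros; [left|]; lra.
    + three_small (fst p' - sg (S (S m))) (sg (S (S (S m))) - fst p') (sg (S (S m)) - sg (S m)).
      intros w Hw Hs. apply small_iff in Hw. apply K. unfold_row. cbn [padd fst snd].
      split; [lra|]. sgm m (S (S m)). split; [lra|].
      split; intros; [right|]; lra.
  - destruct (A4 E') as [G|G].
    + three_small (fst p' - sg m) (sg (S m) - fst p') (sg (S (S m)) - sg (S m)).
      intros w Hw Hs. apply small_iff in Hw. apply K. unfold_row. cbn [padd fst snd].
      split; [lra|]. sgm (S m) (S (S (S m))). split; [lra|].
      split; intros; [|left]; lra.
    + three_small (fst p' - sg (S m)) (sg (S (S (S m))) - fst p') (sg (S (S m)) - sg (S m)).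
      intros w Hw Hs. apply small_iff in Hw. apply K. unfold_row. cbn [padd fst snd].
      split; [lra|]. sgl m (S m). split; [lra|].
      split; intros; [|right]; lra.
  - assert (Hi : sg (S m) < snd p' < sg (S (S m))).
    { split; apply Rnot_le_lt; intro; [apply E|apply E']; lra. }
    set (h := Rmin (snd p' - sg (S m)) (sg (S (S m)) - snd p')).
    assert (Hh : 0 < h /\ h <= snd p' - sg (S m) /\ h <= sg (S (S m)) - snd p').
    { repeat split; [apply Rmin_glb_lt; lra|apply Rmin_l|apply Rmin_r]. }
    clearbody h.
    assert (K' : forall q w, small h w -> snd q = snd p' -> sg m <= fst (padd q w) <= sg (S (S (S m))) -> row m (padd q w)).
    { intros q w Hw Eq Hq. apply small_iff in Hw. unfold_row. cbn [padd fst snd] in *.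
      split; [lra|]. split; [lra|]. split; intros; lra. }
    destruct (Req_dec (fst p') (sg m)) as [F|F]; [|destruct (Req_dec (fst p') (sg (S (S (S m))))) as [F'|F']].
    + two_small h (circ m); [apply circ_pos|]. intros w Hw _.
      destruct (Rle_dec 0 (fst w)) as [W|W].
      { apply K, K'; auto; [now apply small_le with (2 := Hw)|].
        apply small_iff in Hw. rewrite fst_padd. unfold circum in *. cbn [fst snd] in *. lra. }
      (* Moving left from the left side leaves the polygon, so the displacement starts at the glued
         point on the right side and the deck index becomes [z + 1]. *)
      assert (G : row m (padd (sg (S (S (S m))), snd p') w)).
      { apply K'; auto; [now apply small_le with (2 := Hw)|].
        apply small_iff in Hw. rewrite fst_padd. unfold circum in *. cbn [fst snd] in *. lra. }
      destruct (cl_exists _ (row_Dom _ _ G)) as [y Hy]. exists y. split.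
      { exists (z + 1)%Z.
        replace (fst (padd p w) + IZR (z + 1) * circ m, snd (padd p w)) with (padd (sg (S (S (S m))), snd p') w); auto.
        apply pt_eq; simpl; [|easy]. rewrite plus_IZR. simpl in F. unfold circum in *. lra. }
      exists (sg (S (S (S m))), snd p'). split; auto.
      rewrite (rep_eqv x _ _ R1). right; right. apply glue_iff. right. exists m.
      split; [split; auto|]. apply pt_eq; auto.
    + two_small h (circ m); [apply circ_pos|]. intros w Hw _.
      destruct (Rle_dec (fst w) 0) as [W|W].
      { apply K, K'; auto; [now apply small_le with (2 := Hw)|].
        apply small_iff in Hw. rewrite fst_padd. unfold circum in *. cbn [fst snd] in *. lra. }
      assert (G : row m (padd (sg m, snd p') w)).
      { apply K'; auto; [now apply small_le with (2 := Hw)|].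
        apply small_iff in Hw. rewrite fst_padd. unfold circum in *. cbn [fst snd] in *. lra. }
      destruct (cl_exists _ (row_Dom _ _ G)) as [y Hy]. exists y. split.
      { exists (z - 1)%Z.
        replace (fst (padd p w) + IZR (z - 1) * circ m, snd (padd p w)) with (padd (sg m, snd p') w); auto.
        apply pt_eq; simpl; [|easy]. rewrite minus_IZR. simpl in F'. unfold circum in *. lra. }
      exists (sg m, snd p'). split; auto.
      rewrite (rep_eqv x _ _ R1). right; left. apply glue_iff. right. exists m.
      split; [split; auto|]. apply pt_eq; auto.
    + assert (sg m < fst p' < sg (S (S (S m)))).
      { split; apply Rnot_le_lt; intro; [apply F|apply F']; lra. }
      three_small h (fst p' - sg m) (sg (S (S (S m))) - fst p'). intros w Hw _.
      apply K, K'; auto; [now apply small_le with (2 := Hw)|].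
      apply small_iff in Hw. rewrite fst_padd. lra.
Qed.

Lemma cyl_chart m p x : cyl m p x -> exists e, 0 < e /\ forall w y, small e w ->
  cyl m (padd p w) y -> disp x w y.
Proof.
  intros H. destruct (cyl_open _ _ _ H) as [e [He L]]. exists e. split; [easy|].
  intros w y Hw Hy. destruct (L w Hw) as [y' [H1 H2]]; [now apply cyl_range in Hy|].
  now rewrite (cyl_fun _ _ _ _ Hy H1).
Qed.

Lemma disp_cyl m p x : cyl m p x -> exists e, 0 < e /\ forall w y, small e w ->
  sg (S m) <= snd p + snd w <= sg (S (S m)) -> disp x w y -> cyl m (padd p w) y.
Proof.
  intros H. destruct (cyl_open _ _ _ H) as [e1 [He1 L1]], (disp_fun_local x) as [e2 [He2 L2]].
  two_small e1 e2. intros w y Hw Hs Hy.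
  destruct (L1 w) as [y' [H2 H3]]; [now apply small_le with (2 := Hw)|easy|].
  rewrite (L2 w) with (y := y) (y' := y'); auto. now apply small_le with (2 := Hw).
Qed.

(** [lower_edge n] is glued to the top of row [n + 1]. The right bottom arc of row [i] is
    [lower_edge (i + 1)], so cylinder [i + 2] lies below it; the left one borders row [i - 1] inside
    the polygon, except that for [i = 0] it is [lower_edge 0], glued to the top of row 1. *)
Lemma bottom_cases i u x : row i (u, sg (S i)) -> rep x (u, sg (S i)) ->
  (exists j, i = S j /\ sg i < u < sg (S (S i)) /\ cyl j (u, sg (S (S j))) x) \/
  (i = 0%nat /\ sg 1 < u < sg 2 /\ cyl 1 (u, sg 3) x) \/
  (sg (S (S i)) < u < sg (S (S (S i))) /\ cyl (S (S i)) (u, sg (S (S (S (S i))))) x).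
Proof.
  intros [_ [_ [H _]]] Hr. simpl in H. destruct (H eq_refl) as [G|G].
  - destruct i as [|j].
    + right; left. split; [easy|]. rewrite sg_0 in G. rewrite sg_1. split; [easy|].
      apply cyl_row.
      * sgm 2%nat 3%nat. sgm 3%nat 4%nat. unfold_row. simpl. rewrite sg_1. repeat split; intros; lra.
      * rewrite (rep_eqv x _ _ Hr). right; left. apply glue_iff. left. exists 0%nat.
        unfold_edges. simpl. rewrite sg_0, sg_1 in *. repeat split; lra.
    + left. exists j. split; [easy|]. split; [easy|]. apply cyl_row; auto.
      sgm (S j) (S (S j)). sgl j (S j).
      unfold_row. simpl. split; [lra|]. split; [lra|]. split; intros; lra.
  - right; right. split; [easy|]. apply cyl_row.
    + sgm (S (S (S i))) (S (S (S (S i)))). sgm (S (S (S (S i)))) (S (S (S (S (S i))))).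
      unfold_row. simpl. split; [lra|]. split; [lra|]. split; intros; lra.
    + rewrite (rep_eqv x _ _ Hr). right; left. apply glue_iff. left. exists (S i).
      unfold_edges. simpl. auto.
Qed.

Lemma top_cases i u x : row i (u, sg (S (S i))) -> rep x (u, sg (S (S i))) ->
  (sg (S i) < u < sg (S (S (S i))) /\ cyl (S i) (u, sg (S (S i))) x) \/
  (i = 1%nat /\ sg 1 < u < sg 2 /\ cyl 0 (u, sg 1) x) \/
  (exists j, i = S (S j) /\ sg i < u < sg (S i) /\ cyl j (u, sg (S j)) x).
Proof.
  intros [_ [_ [_ H]]] Hr. simpl in H. destruct (H eq_refl) as [G|G].
  - destruct i as [|[|j]].
    + rewrite sg_0, sg_1 in G. lra.
    + right; left. split; [easy|]. split; [easy|]. apply cyl_row.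
      * sgm 1%nat 2%nat. sgm 2%nat 3%nat. unfold_row. simpl. rewrite sg_0, sg_1 in *. repeat split; intros; lra.
      * rewrite (rep_eqv x _ _ Hr). right; right. apply glue_iff. left. exists 0%nat.
        unfold_edges. simpl. rewrite sg_0, sg_1 in *. repeat split; lra.
    + right; right. exists j. split; [easy|]. split; [easy|]. apply cyl_row.
      * sgm (S j) (S (S j)). sgm j (S (S j)). unfold_row. simpl. split; [lra|]. split; [lra|]. split; intros; lra.
      * rewrite (rep_eqv x _ _ Hr). right; right. apply glue_iff. left. exists (S j).
        unfold_edges. simpl. auto.
  - left. split; [easy|]. apply cyl_row; auto.
    sgm (S (S i)) (S (S (S i))). sgm (S (S (S i))) (S (S (S (S i)))).
    unfold_row. simpl. split; [lra|]. split; [lra|]. split; intros; lra.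
Qed.

(* [above i x] : points just above x lie in the i-th horizontal cylinder; likewise [below]. *)
Definition above (i : nat) (x : X lam) := exists p, cyl i p x /\ sg (S i) <= snd p < sg (S (S i)).
Definition below (i : nat) (x : X lam) := exists p, cyl i p x /\ sg (S i) < snd p <= sg (S (S i)).
Definition inside (i : nat) (x : X lam) := exists p, cyl i p x /\ sg (S i) < snd p < sg (S (S i)).

Lemma above_exists x : exists i, above i x.
Proof.
  destruct (rep_exists x) as [r Hr]. destruct (Dom_row r (rep_Dom _ _ Hr)) as [m Hm].
  destruct (Rlt_dec (snd r) (sg (S (S m)))) as [L|L].
  - exists m, r. split; [now apply cyl_row|]. destruct Hm. lra.
  - destruct r as [u v]. simpl in L. destruct (proj1 Hm) as [A B]. simpl in A, B.
    assert (v = sg (S (S m))) by lra. subst v. clear A B L.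
    destruct (top_cases m u x Hm Hr) as [[_ H]|[[-> [_ H]]|[j [-> [_ H]]]]].
    + exists (S m), (u, sg (S (S m))). split; auto. simpl. pose proof (sg_lt_S (lam := lam) (S m)). lra.
    + exists 0%nat, (u, sg 1). split; auto. simpl. pose proof (sg_lt_S (lam := lam) 0). lra.
    + exists j, (u, sg (S j)). split; auto. simpl. pose proof (sg_lt_S (lam := lam) j). lra.
Qed.

Lemma bottom_below i u x : row i (u, sg (S i)) -> rep x (u, sg (S i)) -> exists j, below j x.
Proof.
  intros H1 H2. destruct (bottom_cases i u x H1 H2) as [[j [-> [_ H]]]|[[-> [_ H]]|[_ H]]].
  - exists j, (u, sg (S (S j))). split; auto. simpl. pose proof (sg_lt_S (lam := lam) j). lra.
  - exists 1%nat, (u, sg 3). split; auto. simpl. pose proof (sg_lt_S (lam := lam) 1). lra.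
  - exists (S (S i)), (u, sg (S (S (S (S i))))). split; auto. simpl.
    pose proof (sg_lt_S (lam := lam) (S (S i))). lra.
Qed.

Lemma below_exists x : exists i, below i x.
Proof.
  destruct (rep_exists x) as [r Hr]. destruct (Dom_row r (rep_Dom _ _ Hr)) as [m Hm].
  destruct (Rlt_dec (sg (S m)) (snd r)) as [L|L].
  - exists m, r. split; [now apply cyl_row|]. destruct Hm. lra.
  - destruct r as [u v]. simpl in L. destruct (proj1 Hm) as [A B]. simpl in A, B.
    assert (v = sg (S m)) by lra. subst v. eapply bottom_below; eauto.
Qed.
End Cylinders.

(** * Affine maps and straight paths *)

Lemma small_pscale e v : 0 < e -> exists d, 0 < d /\ forall t, Rabs t < d -> small e (pscale t v).
Proof.
  intros He. set (M := Rabs (fst v) + Rabs (snd v) + 1).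
  pose proof (Rabs_pos (fst v)). pose proof (Rabs_pos (snd v)).
  assert (HM : 0 < M) by (unfold M; lra).
  exists (e / M). split; [apply Rdiv_lt_0_compat; lra|].
  intros t Ht. pose proof (Rabs_pos t).
  assert (Rabs t * M < e).
  { apply (Rmult_lt_compat_r M) in Ht; [|easy]. replace (e / M * M) with e in Ht; [easy|]. field. lra. }
  unfold small. simpl. rewrite !Rabs_mult. unfold M in *. nra.
Qed.

Lemma small_mapply A e : 0 < e -> exists d, 0 < d /\ forall w, small d w -> small e (mapply A w).
Proof.
  intros He. set (M := Rabs (a11 A) + Rabs (a12 A) + Rabs (a21 A) + Rabs (a22 A) + 1).
  pose proof (Rabs_pos (a11 A)). pose proof (Rabs_pos (a12 A)).
  pose proof (Rabs_pos (a21 A)). pose proof (Rabs_pos (a22 A)).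
  assert (HM : 0 < M) by (unfold M; lra).
  exists (e / M). split; [apply Rdiv_lt_0_compat; lra|].
  assert (E : e / M * M = e) by (field; lra).
  assert (Hd : 0 < e / M) by (apply Rdiv_lt_0_compat; lra).
  set (d := e / M) in *.
  assert (K : forall a b u v, Rabs u < d -> Rabs v < d -> Rabs a + Rabs b < M -> Rabs (a * u + b * v) < e).
  { intros a b u v Hu Hv Hab. eapply Rle_lt_trans; [apply Rabs_triang|].
    rewrite !Rabs_mult. pose proof (Rabs_pos a). pose proof (Rabs_pos b).
    assert (Rabs a * Rabs u <= Rabs a * d) by (apply Rmult_le_compat_l; lra).
    assert (Rabs b * Rabs v <= Rabs b * d) by (apply Rmult_le_compat_l; lra).
    nra. }
  intros w [H3 H4]. split; simpl; apply K; auto; unfold M; lra.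
Qed.

Lemma pnorm_small e w : pnorm w < e -> small e w.
Proof.
  unfold pnorm, small. intros H.
  assert (K : forall a b, Rabs a <= sqrt (a * a + b * b)).
  { intros a b. rewrite <- (sqrt_Rsqr_abs a). unfold Rsqr. apply sqrt_le_1; nra. }
  pose proof (K (fst w) (snd w)). pose proof (K (snd w) (fst w)) as K2.
  rewrite Rplus_comm in K2. lra.
Qed.

Lemma small_pnorm e w : small (e / 2) w -> pnorm w < e.
Proof.
  intros H. apply small_iff in H. unfold pnorm.
  rewrite <- (sqrt_square e) by lra. apply sqrt_lt_1; nra.
Qed.

(** Continuous induction, by the supremum of the times up to which [P] holds; it expresses the
    connectedness of the time interval. *)
Lemma real_induction (P : R -> Prop) T :
  P 0 ->
  (forall t, 0 <= t <= T -> P t -> exists e, 0 < e /\ forall t', t < t' < t + e -> t' <= T -> P t') ->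
  (forall t, 0 < t <= T -> (forall t', 0 <= t' < t -> P t') -> P t) ->
  forall t, 0 <= t <= T -> P t.
Proof.
  intros H0 Hopen Hclosed.
  destruct (classic (exists t, 0 <= t <= T /\ ~ P t)) as [[b [Hb Nb]]|N];
    [exfalso|intros t Ht; apply NNPP; intros NP; apply N; eauto].
  set (S := fun s => 0 <= s <= b /\ forall t', 0 <= t' <= s -> P t').
  assert (S0 : S 0).
  { split; [lra|]. intros t' Ht'. now replace t' with 0 by lra. }
  destruct (completeness S) as [m [Hm1 Hm2]].
  - exists b. intros s [Hs _]. lra.
  - now exists 0.
  - assert (0 <= m) by (apply Hm1; auto).
    assert (m <= b) by (apply Hm2; intros s [Hs _]; lra).
    assert (Hlt : forall t', 0 <= t' < m -> P t').
    { intros t' Ht'. apply NNPP. intros NP.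
      assert (m <= t'); [|lra]. apply Hm2. intros s [Hs1 Hs2].
      apply Rnot_lt_le. intros L. apply NP, Hs2. lra. }
    assert (Pm : P m).
    { destruct (Req_dec m 0) as [->|]; auto. apply Hclosed; auto. lra. }
    destruct (Hopen m ltac:(lra) Pm) as [e [He L]].
    assert (m <> b) by congruence.
    set (s := Rmin b (m + e / 2)).
    assert (s <= b /\ s <= m + e / 2 /\ m < s).
    { repeat split; [apply Rmin_l|apply Rmin_r|apply Rmin_glb_lt; lra]. }
    assert (HS : S s).
    { split; [lra|]. intros t' Ht'. destruct (Rtotal_order t' m) as [G|[->|G]]; auto.
      - apply Hlt. lra.
      - apply L; lra. }
    apply Hm1 in HS. lra.
Qed.

Section Affine.
Context {lam : R} {Hlam : ladder_ratio lam}.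
Local Notation sg := (lsum lam).
Local Notation circ := (circum lam).

Definition affine_map (f : X lam -> X lam) (A : Mat) : Prop :=
  forall x, exists e, 0 < e /\ forall w y, small e w -> disp x w y -> disp (f x) (mapply A w) (f y).

(** [disp] absorbs the choice of representatives; the radius is halved because a box of half-side
    [e / 2] lies in the disc of radius [e]. *)
Lemma affine_with_iff f A : affine_with lam f A <-> bij f /\ affine_map f A.
Proof.
  split; intros [Hb H]; (split; [exact Hb|]); intros x; destruct (H x) as [e [He L]].
  - exists (e / 2). split; [lra|]. intros w y Hw [r [H1 H2]].
    destruct (L w (small_pnorm _ _ Hw) r H1 (rep_Dom _ _ H2)) as [s0 [H3 H4]].
    exists s0. auto.
  - exists e. split; [easy|]. intros v Hv r Hr HD.
    destruct (cl_exists _ HD) as [y Hy].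
    destruct (L v y (pnorm_small _ _ Hv)) as [s0 [H3 H4]]; [exists r; auto|].
    exists s0. split; [easy|]. intros y' Hy'. now rewrite (rep_unique y' y _ Hy' Hy).
Qed.

(** The point may lie on a horizontal boundary, so upward displacements are made in the cylinder
    above it and downward ones in the cylinder below. *)
Lemma disp_open (x : X lam) : exists e, 0 < e /\ forall w, small e w -> exists y, disp x w y.
Proof.
  destruct (above_exists x) as [i [p [H1 H2]]], (below_exists x) as [j [q [H3 H4]]].
  destruct (cyl_open _ _ _ H1) as [e1 [He1 L1]], (cyl_open _ _ _ H3) as [e2 [He2 L2]].
  three_small e1 e2 (Rmin (sg (S (S i)) - snd p) (snd q - sg (S j))).
  pose proof (Rmin_l (sg (S (S i)) - snd p) (snd q - sg (S j))).
  pose proof (Rmin_r (sg (S (S i)) - snd p) (snd q - sg (S j))).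
  intros w Hw. pose proof (proj1 (small_iff _ _) Hw).
  destruct (Rle_dec 0 (snd w)).
  - destruct (L1 w) as [y [_ Hy]]; [apply small_le with (2 := Hw); lra|lra|]. eauto.
  - destruct (L2 w) as [y [_ Hy]]; [apply small_le with (2 := Hw); lra|lra|]. eauto.
Qed.

Lemma affine_map_comp f g A B : affine_map f A -> affine_map g B ->
  affine_map (fun x => f (g x)) (mmul A B).
Proof.
  intros Hf Hg x. destruct (Hg x) as [e1 [He1 L1]], (Hf (g x)) as [e2 [He2 L2]].
  destruct (small_mapply B e2 He2) as [e3 [He3 L3]].
  two_small e1 e3. intros w y Hw Hy.
  replace (mapply (mmul A B) w) with (mapply A (mapply B w)) by (apply pt_eq; simpl; ring).
  apply L2; [apply L3|apply L1; auto]; now apply small_le with (2 := Hw).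
Qed.

Lemma mapply_minv A w : mdet A <> 0 -> mapply A (mapply (minv A) w) = w.
Proof. intros H. unfold mdet in H. apply pt_eq; simpl; unfold mdet; field; exact H. Qed.

(** The point [g z] is displaced by the inverse matrix first; the image of the result under [f] is
    then identified with [z'] by local uniqueness of displacements at [z]. *)
Lemma affine_map_inv f g A : mdet A <> 0 -> affine_map f A ->
  (forall x, g (f x) = x) -> (forall x, f (g x) = x) -> affine_map g (minv A).
Proof.
  intros HA Hf Hgf Hfg z. destruct (Hf (g z)) as [e1 [He1 L1]].
  destruct (disp_open (g z)) as [e2 [He2 L2]], (disp_fun_local z) as [e3 [He3 L3]].
  destruct (small_mapply (minv A) (Rmin e1 e2)) as [e4 [He4 L4]]; [now apply Rmin_glb_lt|].
  pose proof (Rmin_l e1 e2). pose proof (Rmin_r e1 e2).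
  two_small e3 e4. intros w z' Hw Hz.
  specialize (L4 w ltac:(now apply small_le with (2 := Hw))).
  destruct (L2 (mapply (minv A) w)) as [y Hy]; [now apply small_le with (2 := L4)|].
  assert (E : f y = z').
  { apply (L3 w); auto; [now apply small_le with (2 := Hw)|].
    apply L1 in Hy as G; [|now apply small_le with (2 := L4)].
    rewrite mapply_minv, Hfg in G; auto. }
  now rewrite <- E, Hgf.
Qed.

Lemma mdet_mmul A B : mdet (mmul A B) = mdet A * mdet B.
Proof. unfold mdet, mmul. simpl. ring. Qed.

Lemma mdet_minv A : mdet A <> 0 -> mdet (minv A) = / mdet A.
Proof. intros H. unfold mdet in *. simpl. unfold mdet. field. exact H. Qed.

Lemma derivative_mmul A B : derivative lam A -> derivative lam B -> derivative lam (mmul A B).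
Proof.
  intros [f [Hf HA]] [g [Hg HB]]. apply affine_with_iff in Hf as [[f' [Hf1 Hf2]] Hf], Hg as [[g' [Hg1 Hg2]] Hg].
  exists (fun x => f (g x)). split; [|rewrite mdet_mmul; now apply Rmult_lt_0_compat].
  apply affine_with_iff. split; [|now apply affine_map_comp].
  exists (fun x => g' (f' x)). split; intros; [now rewrite Hf1|now rewrite Hg2].
Qed.

Lemma derivative_minv A : derivative lam A -> derivative lam (minv A).
Proof.
  intros [f [Hf HA]]. apply affine_with_iff in Hf as [[f' [Hf1 Hf2]] Hf].
  exists f'. split; [|rewrite mdet_minv by lra; now apply Rinv_0_lt_compat].
  apply affine_with_iff. split; [now exists f|]. apply affine_map_inv with f; auto. lra.
Qed.

Lemma derivative_mid : derivative lam mid.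
Proof.
  exists (fun x => x). split; [|unfold mdet; simpl; lra].
  apply affine_with_iff. split; [now exists (fun x => x)|].
  intros x. exists 1. split; [lra|]. intros w y _ H.
  replace (mapply mid w) with w; auto. apply pt_eq; simpl; ring.
Qed.

Definition swapX (x : X lam) : X lam.
Proof.
  exists (fun p => rep x (swap p)). destruct x as [C [p [H ->]]]. exists (swap p).
  split; [now apply Dom_swap|]. unfold rep. simpl. extensionality q.
  apply propositional_extensionality. split; intros G; apply eqv_swap in G; now rewrite swap_swap in G.
Defined.

Lemma rep_swapX x p : rep (swapX x) p <-> rep x (swap p).
Proof. reflexivity. Qed.

Lemma swapX_swapX x : swapX (swapX x) = x.
Proof.
  destruct (rep_exists x) as [p Hp]. apply rep_unique with p; auto.
  rewrite !rep_swapX. now rewrite swap_swap.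
Qed.

Lemma disp_swapX x w y : disp x w y -> disp (swapX x) (swap w) (swapX y).
Proof.
  intros [r [H1 H2]]. exists (swap r). rewrite !rep_swapX. rewrite swap_padd, !swap_swap. auto.
Qed.

Lemma affine_map_swapX : affine_map swapX (mkMat 0 1 1 0).
Proof.
  intros x. exists 1. split; [lra|]. intros w y _ H. apply disp_swapX in H.
  replace (mapply (mkMat 0 1 1 0) w) with (swap w); auto. apply pt_eq; simpl; ring.
Qed.

Lemma cyl_cover (x : X lam) : exists i p j q e, 0 < e /\ cyl i p x /\ cyl j q x /\
  forall w y, small e w -> disp x w y -> cyl i (padd p w) y \/ cyl j (padd q w) y.
Proof.
  destruct (above_exists x) as [i [p [H1 H2]]], (below_exists x) as [j [q [H3 H4]]].
  destruct (disp_cyl _ _ _ H1) as [e1 [He1 L1]], (disp_cyl _ _ _ H3) as [e2 [He2 L2]].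
  exists i, p, j, q.
  three_small e1 e2 (Rmin (sg (S (S i)) - snd p) (snd q - sg (S j))).
  pose proof (Rmin_l (sg (S (S i)) - snd p) (snd q - sg (S j))).
  pose proof (Rmin_r (sg (S (S i)) - snd p) (snd q - sg (S j))).
  split; [easy|]. split; [easy|].
  intros w y Hw Hy. pose proof (proj1 (small_iff _ _) Hw).
  destruct (Rle_dec 0 (snd w)).
  - left. apply L1; auto; [apply small_le with (2 := Hw); lra|lra].
  - right. apply L2; auto; [apply small_le with (2 := Hw); lra|lra].
Qed.

(* [Bd] prescribes the map on the horizontal boundaries, where two cylinders have to agree. *)
Lemma affine_from_cylinders (G : nat -> pt -> pt) A (Bd : X lam -> X lam -> Prop) :
  (forall m p w, G m (padd p w) = padd (G m p) (mapply A w)) ->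
  (forall m p, snd (G m p) = snd p) ->
  (forall m p z, exists z', G m (fst p + IZR z * circ m, snd p) = (fst (G m p) + IZR z' * circ m, snd p)) ->
  (forall x z z', Bd x z -> Bd x z' -> z = z') ->
  (forall m p (x : X lam), cyl m p x -> snd p = sg (S m) \/ snd p = sg (S (S m)) ->
     exists z : X lam, cyl m (G m p) z /\ Bd x z) ->
  exists f, affine_map f A /\ forall m p (x : X lam), cyl m p x -> cyl m (G m p) (f x).
Proof.
  intros HG Hsnd Hper Hfun Hbd.
  assert (Hint : forall m p (x : X lam), cyl m p x ->
    sg (S m) < snd p < sg (S (S m)) \/ (snd p = sg (S m) \/ snd p = sg (S (S m)))).
  { intros m p x H. apply cyl_range in H. lra. }
  assert (T : forall m p (x : X lam), cyl m p x -> exists z : X lam, cyl m (G m p) z).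
  { intros m p x H. destruct (Hint m p x H) as [I|I].
    - apply cyl_exists. now rewrite Hsnd.
    - destruct (Hbd _ _ _ H I) as [z [Hz _]]. eauto. }
  (* The value is independent of the coordinates: an interior point determines its cylinder and, up
     to periods, its position; on boundaries [Bd] decides. *)
  assert (U : forall m p n q (x z z' : X lam), cyl m p x -> cyl m (G m p) z ->
    cyl n q x -> cyl n (G n q) z' -> z = z').
  { intros m p n q x z z' H1 H2 H3 H4.
    assert (K : sg (S m) < snd p < sg (S (S m)) -> z = z').
    { intros I. assert (n = m) by (eapply (cyl_interior_unique m n p q x); eauto). subst n.
      destruct (cyl_inj _ _ _ _ H1 H3) as [E1 [k E2]]. destruct (Hper m p k) as [k' E3].
      replace q with (fst p + IZR k * circ m, snd p) in H4 by (apply pt_eq; auto).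
      rewrite E3 in H4. apply cyl_shift with (z := k') in H2. rewrite Hsnd in H2.
      eapply cyl_fun; eauto. }
    destruct (Hint _ _ _ H1) as [I|I]; [auto|].
    destruct (Hint _ _ _ H3) as [J|J].
    - assert (m = n) by (eapply (cyl_interior_unique n m q p x); eauto). subst n.
      destruct (cyl_inj _ _ _ _ H1 H3) as [E1 _]. apply K. lra.
    - destruct (Hbd _ _ _ H1 I) as [y [Hy1 Hy2]], (Hbd _ _ _ H3 J) as [y' [Hy3 Hy4]].
      rewrite (cyl_fun _ _ _ _ H2 Hy1), (cyl_fun _ _ _ _ H4 Hy3). eapply Hfun; eauto. }
  assert (E : forall x : X lam, exists z : X lam, exists m p, cyl m p x /\ cyl m (G m p) z).
  { intros x. destruct (above_exists x) as [m [p [H _]]].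
    destruct (T _ _ _ H) as [z Hz]. eauto. }
  destruct (choice _ E) as [f Hf].
  assert (K : forall m p (x : X lam), cyl m p x -> cyl m (G m p) (f x)).
  { intros m p x H. destruct (T _ _ _ H) as [z Hz]. destruct (Hf x) as [n [q [B1 B2]]].
    now rewrite (U _ _ _ _ _ _ _ B1 B2 H Hz). }
  exists f. split; [|exact K].
  intros x. destruct (cyl_cover x) as [m1 [p1 [m2 [p2 [e [He [A1 [A2 L]]]]]]]].
  destruct (cyl_chart _ _ _ (K _ _ _ A1)) as [e1 [He1 L1]].
  destruct (cyl_chart _ _ _ (K _ _ _ A2)) as [e2 [He2 L2]].
  destruct (small_mapply A (Rmin e1 e2)) as [e3 [He3 L3]]; [now apply Rmin_glb_lt|].
  pose proof (Rmin_l e1 e2). pose proof (Rmin_r e1 e2).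
  two_small e e3. intros w y Hw Hy.
  specialize (L3 w ltac:(now apply small_le with (2 := Hw))).
  apply L in Hy; [|now apply small_le with (2 := Hw)].
  destruct Hy as [Hy|Hy]; apply K in Hy; rewrite HG in Hy.
  - apply L1; auto. now apply small_le with (2 := L3).
  - apply L2; auto. now apply small_le with (2 := L3).
Qed.

(** The time interval is closed: the path must arrive at a point of the surface at time [T], so it
    cannot end at a missing vertex. *)
Definition straight (T : R) (v : pt) (g : R -> X lam) : Prop :=
  forall t, 0 <= t <= T -> exists e, 0 < e /\
    forall t', 0 <= t' <= T -> Rabs (t' - t) < e -> disp (g t) (pscale (t' - t) v) (g t').

Lemma straight_restrict T T' v g : T' <= T -> straight T v g -> straight T' v g.
Proof.
  intros HT H t Ht. destruct (H t) as [e [He L]]; [lra|]. exists e. split; [easy|].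
  intros. apply L; auto. lra.
Qed.

(** Agreement extends forward by local uniqueness of displacements and passes to limit times by
    [disp_separated]. *)
Lemma straight_unique T v g h : straight T v g -> straight T v h -> g 0 = h 0 ->
  forall t, 0 <= t <= T -> g t = h t.
Proof.
  intros Hg Hh H0. apply real_induction; auto.
    - intros t Ht E. destruct (Hg t Ht) as [e1 [He1 L1]], (Hh t Ht) as [e2 [He2 L2]].
      destruct (disp_fun_local (g t)) as [e3 [He3 L3]].
      destruct (small_pscale e3 v He3) as [e4 [He4 L4]].
      three_small e1 e2 e4. intros t' Ht' HT.
      assert (D : forall e, Rmin e1 (Rmin e2 e4) <= e -> Rabs (t' - t) < e).
      { intros. rewrite Rabs_right; lra. }
      apply (L3 (pscale (t' - t) v)).
      + apply L4, D. lra.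
      + apply L1; [lra|]. now apply D.
      + rewrite E. apply L2; [lra|]. apply D. lra.
    - intros t Ht IH. destruct (Hg t) as [e1 [He1 L1]], (Hh t) as [e2 [He2 L2]]; try lra.
      destruct (disp_separated (g t) (h t)) as [e3 [He3 L3]].
      destruct (small_pscale e3 v He3) as [e4 [He4 L4]].
      set (d := Rmin (Rmin e1 e2) (Rmin e4 t) / 2).
      assert (0 < d /\ d < e1 /\ d < e2 /\ d < e4 /\ d < t).
      { pose proof (Rmin_l (Rmin e1 e2) (Rmin e4 t)). pose proof (Rmin_r (Rmin e1 e2) (Rmin e4 t)).
        pose proof (Rmin_l e1 e2). pose proof (Rmin_r e1 e2).
        pose proof (Rmin_l e4 t). pose proof (Rmin_r e4 t).
        assert (0 < Rmin (Rmin e1 e2) (Rmin e4 t)) by (repeat apply Rmin_glb_lt; lra).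
        unfold d. lra. }
      assert (D : Rabs (t - d - t) = d) by (rewrite Rabs_left; lra).
      apply (L3 (pscale (t - d - t) v)) with (g (t - d)).
      + apply L4. rewrite D. lra.
      + apply L1; [lra|]. rewrite D. lra.
      + rewrite IH by lra. apply L2; [lra|]. rewrite D. lra.
Qed.

Lemma straight_image f A T v g : affine_map f A -> straight T v g ->
  straight T (mapply A v) (fun t => f (g t)).
Proof.
  intros Hf Hg t Ht. destruct (Hg t Ht) as [e1 [He1 L1]], (Hf (g t)) as [e2 [He2 L2]].
  destruct (small_pscale e2 v He2) as [e3 [He3 L3]].
  two_small e1 e3. intros t' Ht' D.
  replace (pscale (t' - t) (mapply A v)) with (mapply A (pscale (t' - t) v)) by (apply pt_eq; simpl; ring).
  apply L2; [apply L3; lra|]. apply L1; auto. lra.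
Qed.

Lemma straight_cyl m p T v g : (forall t, 0 <= t <= T -> cyl m (padd p (pscale t v)) (g t)) ->
  straight T v g.
Proof.
  intros H t Ht. destruct (cyl_chart _ _ _ (H t Ht)) as [e [He L]].
  destruct (small_pscale e v He) as [d [Hd L']]. exists d. split; [easy|].
  intros t' Ht' D. apply L; [now apply L'|].
  replace (padd (padd p (pscale t v)) (pscale (t' - t) v)) with (padd p (pscale t' v)); auto.
  apply pt_eq; simpl; ring.
Qed.

(* [Phi m p] is arbitrary where [cyl m p] is empty. *)
Lemma cyl_param (x0 : X lam) : exists Phi : nat -> pt -> X lam, forall m p (x : X lam), cyl m p x -> cyl m p (Phi m p).
Proof.
  exists (fun m p => epsilon (inhabits x0) (cyl m p)). intros m p x H. apply epsilon_spec. eauto.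
Qed.
End Affine.

(** * The two generators *)

Section Generators.
Context {lam : R} {Hlam : ladder_ratio lam}.
Local Notation sg := (lsum lam).
Local Notation circ := (circum lam).
Local Notation eqv := (eqv lam).
Local Notation row := (@row lam).
Local Notation cyl := (@cyl lam).
Local Notation rep := (@rep lam).

Definition twist (tau : R) (m : nat) (p : pt) : pt := (fst p + tau * (snd p - sg (S m)), snd p).

(** Cylinder [m] has height [lam ^ m], so the shear fixes its bottom and makes whole turns at its
    top. All boundaries are fixed pointwise, whence [Bd := eq]. *)
Lemma twist_affine tau : (forall m, exists N, tau * lam ^ m = IZR N * circ m) ->
  exists f : X lam -> X lam, affine_map f (mkMat 1 tau 0 1) /\
    forall m p x, cyl m p x -> cyl m (twist tau m p) (f x).
Proof.
  intros Htau. apply affine_from_cylinders with (Bd := eq).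
  - intros m p w. apply pt_eq; simpl; ring.
  - reflexivity.
  - intros m p z. exists z. apply pt_eq; simpl; ring.
  - congruence.
  - intros m p x H [E|E]; exists x; (split; [|easy]); unfold twist.
    + replace (fst p + tau * (snd p - sg (S m)), snd p) with p; auto.
      apply pt_eq; simpl; auto. rewrite E. ring.
    + destruct (Htau m) as [N HN]. apply cyl_shift with (z := N) in H.
      replace (fst p + tau * (snd p - sg (S m))) with (fst p + IZR N * circ m); auto.
      rewrite E, sg_step. lra.
Qed.

Lemma derivative_twist tau : (forall m, exists N, tau * lam ^ m = IZR N * circ m) ->
  derivative lam (mkMat 1 tau 0 1).
Proof.
  intros H. destruct (twist_affine tau H) as [f [Hf1 Hf2]].
  assert (H' : forall m, exists N, - tau * lam ^ m = IZR N * circ m).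
  { intros m. destruct (H m) as [N HN]. exists (- N)%Z. rewrite opp_IZR. lra. }
  destruct (twist_affine (- tau) H') as [g [Hg1 Hg2]].
  exists f. split; [|unfold mdet; simpl; lra]. apply affine_with_iff. split; [|easy].
  exists g. split; intros x; destruct (above_exists x) as [m [p [Hp _]]];
    apply cyl_fun with (m := m) (p := p); auto.
  - replace p with (twist (- tau) m (twist tau m p)) by (apply pt_eq; simpl; ring). auto.
  - replace p with (twist tau m (twist (- tau) m p)) by (apply pt_eq; simpl; ring). auto.
Qed.

(* The affine involution [(-1 -1; 0 1)], which flips every horizontal saddle connection;
   [Rmat] is its composition with the reflection in the diagonal. *)
Definition flip (m : nat) (p : pt) : pt := (sg m + sg (S m) + sg (S (S m)) - snd p - fst p, snd p).

(* Every horizontal saddle connection is either in the interior of the polygon or an upper edge. *)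
Definition flip_saddle (x z : X lam) : Prop :=
  (exists n u, sg (S n) < u < sg (S (S (S n))) /\ rep x (u, sg (S (S n))) /\
     rep z (sg (S n) + sg (S (S (S n))) - u, sg (S (S n)))) \/
  (exists n u, sg (S n) < u < sg (S (S n)) /\ rep x (u, sg (S (S (S n)))) /\
     rep z (sg (S n) + sg (S (S n)) - u, sg (S (S (S n))))).

(** A point on an inner saddle connection is alone in its class, and points of upper edges are never
    glued to each other; so [x] determines its saddle connection and its position there. *)
Lemma flip_saddle_fun x z z' : flip_saddle x z -> flip_saddle x z' -> z = z'.
Proof.
  assert (I : forall n u, sg (S n) < u < sg (S (S (S n))) -> forall q, eqv (u, sg (S (S n))) q ->
    q = (u, sg (S (S n)))).
  { intros n u H q [E|[E|E]]; [easy| |]; exfalso; apply glue_iff in E as [[j [[E1 E2] E3]]|[j [[E1 E2] E3]]]; simpl in *.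
    - symmetry in E2. apply sg_eq_inv in E2. subst j. lra.
    - now apply sg_not_between in E1.
    - apply (f_equal fst) in E3 as E4. apply (f_equal snd) in E3. simpl in *. symmetry in E3.
      apply sg_eq_inv in E3. assert (n = S j) by lia. subst n.
      sgm (S (S j)) (S (S (S j))). lra.
    - apply (f_equal snd) in E3. simpl in *. rewrite <- E3 in E1. now apply sg_not_between in E1. }
  intros [[n [u [H1 [H2 H3]]]]|[n [u [H1 [H2 H3]]]]] [[m [v [G1 [G2 G3]]]]|[m [v [G1 [G2 G3]]]]].
  - rewrite (rep_eqv x _ _ H2) in G2. apply (I n u H1) in G2. injection G2 as E1 E2.
    symmetry in E2. apply sg_eq_inv in E2. injection E2 as ->. subst v. eapply rep_unique; eauto.
  - exfalso. rewrite (rep_eqv x _ _ H2) in G2. apply (I n u H1) in G2. injection G2 as E1 E2.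
    symmetry in E2. apply sg_eq_inv in E2. injection E2 as ->. lra.
  - exfalso. rewrite (rep_eqv x _ _ G2) in H2. apply (I m v G1) in H2. injection H2 as E1 E2.
    symmetry in E2. apply sg_eq_inv in E2. injection E2 as ->. lra.
  - assert (U : forall n u, sg (S n) < u < sg (S (S n)) -> is_L (lam := lam) (swap (u, sg (S (S (S n)))))).
    { intros k w Hw. right. exists k. now split. }
    rewrite (rep_eqv x _ _ H2) in G2. destruct G2 as [E|[E|E]].
    + injection E as E1 E2. symmetry in E2. apply sg_eq_inv in E2. injection E2 as ->. subst v.
      eapply rep_unique; eauto.
    + exfalso. apply glue_is_L in E. eapply L_U_disjoint; eauto.
    + exfalso. apply glue_is_L in E. eapply L_U_disjoint; eauto.
Qed.

(** The constant in [flip] is chosen for this: at either boundary height it becomes the sum of the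
    two ends of the left arc, and adding one period gives the sum for the right arc. Hence [l] is 0
    on left arcs and 1 on right arcs. *)
Lemma flip_boundary m p (x : X lam) :
  cyl m p x -> snd p = sg (S m) \/ snd p = sg (S (S m)) ->
  exists z, cyl m (flip m p) z /\ flip_saddle x z.
Proof.
  intros [k [Hr Hx]] Hb.
  assert (K : forall l z, cyl m (sg m + sg (S m) + sg (S (S m)) - snd p - (fst p + IZR k * circ m) + IZR l * circ m, snd p) z ->
    cyl m (flip m p) z).
  { intros l z Hz. apply cyl_shift with (z := (k - l)%Z) in Hz. simpl in Hz.
    replace (flip m p) with (sg m + sg (S m) + sg (S (S m)) - snd p - (fst p + IZR k * circ m) +
      IZR l * circ m + IZR (k - l) * circ m, snd p); auto.
    apply pt_eq; simpl; auto. rewrite minus_IZR. ring. }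
  set (u := fst p + IZR k * circ m) in *. destruct p as [p1 h]. simpl in *. clearbody u.
  pose proof (sg_lt_S (lam := lam) m) as M1. pose proof (sg_lt_S (lam := lam) (S m)) as M2.
  pose proof (sg_le_S (lam := lam) m) as M0. unfold circum in K.
  assert (Z : forall v, row m (v, h) -> exists z : X lam, rep z (v, h) /\ cyl m (v, h) z).
  { intros v Hv. destruct (cl_exists _ (row_Dom _ _ Hv)) as [z Hz]. exists z. split; [easy|].
    now apply cyl_row. }
  assert (Hm : forall a b, row m (u, h) -> a < u < b -> (forall v, a < v < b -> row m (v, h)) ->
    (exists l, sg m + sg (S m) + sg (S (S m)) - h - u + IZR l * (sg (S (S (S m))) - sg m) = a + b - u) ->
    (forall z, rep z (a + b - u, h) -> flip_saddle x z) ->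
    exists z, cyl m (flip m (p1, h)) z /\ flip_saddle x z).
  { intros a b _ Hu Hrow [l Hl] Hf. destruct (Z (a + b - u)) as [z [Hz1 Hz2]]; [apply Hrow; lra|].
    exists z. split; [|auto]. apply (K l). now rewrite Hl. }
  destruct Hb as [E|E]; subst h.
  - destruct Hr as [Hr1 [Hr2 [Hr3 Hr4]]]. destruct (Hr3 eq_refl) as [G|G]; simpl in G.
    + apply (Hm (sg m) (sg (S (S m)))); [now split| |..|exists 0%Z|]; try lra.
      * intros v Hv. unfold_row. simpl. split; [lra|]. split; [lra|]. split; intros; [left|]; lra.
      * intros z Hz. destruct m as [|m].
        (* For [m = 0] the left bottom arc is a lower edge; [flip_saddle] lists it through the upper
           edge glued to it. *)
        { right. exists 0%nat, u. rewrite sg_0 in *. rewrite sg_1 in *. split; [lra|].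
          assert (Q : forall y v, 0 < v < sg 2 -> rep y (v, 0) -> rep y (v, sg 3)).
          { intros y v Hv Hy. rewrite (rep_eqv y _ _ Hy). right; left. apply glue_iff. left.
            exists 0%nat. unfold_edges. simpl. rewrite sg_0, sg_1. split; [split|]; auto. }
          split; apply Q; auto; lra. }
        { left. exists m, u. split; [lra|]. auto. }
    + apply (Hm (sg (S (S m))) (sg (S (S (S m))))); [now split| |..|exists 1%Z|]; try lra.
      * intros v Hv. unfold_row. simpl. split; [lra|]. split; [lra|]. split; intros; [right|]; lra.
      * intros z Hz. right. exists (S m), u. split; [lra|].
        assert (Q : forall y v, sg (S (S m)) < v < sg (S (S (S m))) -> rep y (v, sg (S m)) -> rep y (v, sg (S (S (S (S m)))))).
        { intros y v Hv Hy. rewrite (rep_eqv y _ _ Hy). right; left. apply glue_iff. left.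
          exists (S m). unfold_edges. simpl. split; [split|]; auto. }
        split; apply Q; auto; lra.
  - destruct Hr as [Hr1 [Hr2 [Hr3 Hr4]]]. destruct (Hr4 eq_refl) as [G|G]; simpl in G.
    + apply (Hm (sg m) (sg (S m))); [now split| |..|exists 0%Z|]; try lra.
      * intros v Hv. unfold_row. simpl. split; [lra|]. split; [lra|]. split; intros; [|left]; lra.
      * intros z Hz. destruct m as [|m]; [rewrite sg_0, sg_1 in *; lra|].
        right. exists m, u. split; [lra|]. auto.
    + apply (Hm (sg (S m)) (sg (S (S (S m))))); [now split| |..|exists 1%Z|]; try lra.
      * intros v Hv. unfold_row. simpl. split; [lra|]. split; [lra|]. split; intros; [|right]; lra.
      * intros z Hz. left. exists m, u. split; [lra|]. auto.
Qed.

Lemma flip_affine : exists f : X lam -> X lam, affine_map f (mkMat (-1) (-1) 0 1) /\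
  forall m p x, cyl m p x -> cyl m (flip m p) (f x).
Proof.
  apply affine_from_cylinders with (Bd := flip_saddle).
  - intros m p w. apply pt_eq; simpl; ring.
  - reflexivity.
  - intros m p z. exists (- z)%Z. rewrite opp_IZR. apply pt_eq; simpl; ring.
  - apply flip_saddle_fun.
  - apply flip_boundary.
Qed.

Lemma derivative_Rmat : derivative lam Rmat.
Proof.
  destruct flip_affine as [f [Hf1 Hf2]].
  assert (Hff : forall x, f (f x) = x).
  { intros x. destruct (above_exists x) as [m [p [Hp _]]].
    apply cyl_fun with (m := m) (p := p); auto.
    replace p with (flip m (flip m p)) by (apply pt_eq; simpl; ring). auto. }
  exists (fun x => f (swapX x)). split; [|unfold mdet; simpl; lra]. apply affine_with_iff. split.
  - exists (fun x => swapX (f x)). split; intros x.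
    + now rewrite Hff, swapX_swapX.
    + now rewrite swapX_swapX, Hff.
  - replace Rmat with (mmul (mkMat (-1) (-1) 0 1) (mkMat 0 1 1 0)).
    + apply affine_map_comp; [easy|apply affine_map_swapX].
    + unfold Rmat, mmul. simpl. f_equal; ring.
Qed.
End Generators.

(** * Directions of derivatives *)

Section Directions.
Context {lam : R} {Hlam : ladder_ratio lam}.
Local Notation sg := (lsum lam).
Local Notation circ := (circum lam).
Local Notation Dom := (Dom lam).
Local Notation cyl := (@cyl lam).
Local Notation rep := (@rep lam).
Local Notation lim := (@sg_lim lam).

Lemma cyl_path i p x v T : cyl i p x ->
  (forall t, 0 < t <= T -> exists y, cyl i (padd p (pscale t v)) y) ->
  exists g, g 0 = x /\ forall t, 0 <= t <= T -> cyl i (padd p (pscale t v)) (g t).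
Proof.
  intros Hx H. destruct (cyl_param x) as [Phi HPhi].
  exists (fun t => Phi i (padd p (pscale t v))).
  assert (E : padd p (pscale 0 v) = p) by (apply pt_eq; simpl; ring).
  split.
  - rewrite E. eapply cyl_fun; eauto.
  - intros t Ht. destruct (Req_dec t 0) as [->|N].
    + rewrite E. eapply HPhi; eauto.
    + destruct (H t ltac:(lra)) as [y Hy]. eapply HPhi; eauto.
Qed.

Lemma cyl_path_interior i p x v T : cyl i p x ->
  (forall t, 0 < t <= T -> sg (S i) < snd p + t * snd v < sg (S (S i))) ->
  exists g, g 0 = x /\ forall t, 0 <= t <= T -> cyl i (padd p (pscale t v)) (g t).
Proof.
  intros Hx H. apply cyl_path; auto. intros t Ht. apply cyl_exists. simpl. auto.
Qed.

(** Only the height of [v] is bounded, since a cylinder is unlimited horizontally in its cover. With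
    [snd v <> 0] the path leaves the horizontal boundary at once and so misses its vertices. *)
Lemma straight_strip (x : X lam) : exists h, 0 < h /\
  forall v, snd v <> 0 -> Rabs (snd v) < h -> exists g, straight 1 v g /\ g 0 = x.
Proof.
  destruct (above_exists x) as [i [p [H1 H2]]], (below_exists x) as [j [q [H3 H4]]].
  two_small (sg (S (S i)) - snd p) (snd q - sg (S j)).
  intros v Hv0 Hv. apply Rabs_def2 in Hv.
  destruct (Rlt_dec 0 (snd v)).
  - destruct (cyl_path_interior i p x v 1) as [g [G0 G1]]; auto.
    { intros t Ht. nra. }
    exists g. split; auto. eapply straight_cyl; eauto.
  - assert (snd v < 0) by lra.
    destruct (cyl_path_interior j q x v 1) as [g [G0 G1]]; auto.
    { intros t Ht. nra. }
    exists g. split; auto. eapply straight_cyl; eauto.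
Qed.

Lemma Omega_not_L p : Omega lam p -> is_L (lam := lam) p -> False.
Proof.
  intros H. apply Omega_iff in H as [[n [H1 H2]] _].
  intros [[m [G1 G2]]|[m [G1 G2]]]; simpl in *.
  - assert (m = n) by (apply (interval_unique (lam := lam) m n (fst p)); lra). subst m. lra.
  - rewrite G2 in H1.
    assert (S (S (S m)) < S (S n))%nat by (apply (sg_inv_lt (lam := lam)); lra).
    sgl (S (S m)) n. lra.
Qed.

Lemma Omega_swap p : Omega lam p -> Omega lam (swap p).
Proof. intros [H1 H2]. now split. Qed.

Lemma Omega_rep (x : X lam) p q : Omega lam p -> rep x p -> rep x q -> q = p.
Proof.
  intros H Hp Hq. rewrite (rep_eqv x p q Hp) in Hq. destruct Hq as [E|[E|E]]; [easy| |]; exfalso.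
  - apply glue_is_L in E. eapply Omega_not_L; eauto.
  - apply glue_is_U in E. eapply Omega_not_L; [apply Omega_swap|]; eauto.
Qed.

(** By uniqueness the path follows the segment in the polygon. Shortly before the end its only
    representative is the point on the segment, and the displacement to time 1 would put [padd q v]
    in [Dom]. *)
Lemma no_path_to_vertex (x : X lam) q v g : rep x q ->
  (forall t, 0 <= t < 1 -> Omega lam (padd q (pscale t v))) -> ~ Dom (padd q v) ->
  straight 1 v g -> g 0 = x -> False.
Proof.
  intros Hx HO HN Hg G0.
  assert (E : forall t, exists y : X lam, 0 <= t < 1 -> rep y (padd q (pscale t v))).
  { intros t. destruct (classic (0 <= t < 1)) as [Ht|Ht].
    - destruct (cl_exists (lam := lam) (padd q (pscale t v))) as [y Hy]; [left; auto|]. eauto.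
    - exists x. intros. contradiction. }
  destruct (choice _ E) as [h Hh].
  assert (K : forall t, 0 <= t < 1 -> rep (g t) (padd q (pscale t v))).
  { intros T HT. rewrite (straight_unique T v g h).
    - auto.
    - eapply straight_restrict; eauto. lra.
    - intros t Ht. exists 1. split; [lra|]. intros t' Ht' _. exists (padd q (pscale t v)).
      split; [apply Hh; lra|].
      replace (padd (padd q (pscale t v)) (pscale (t' - t) v)) with (padd q (pscale t' v))
        by (apply pt_eq; simpl; ring). apply Hh. lra.
    - rewrite G0. eapply rep_unique; [eauto|].
      replace q with (padd q (pscale 0 v)) at 1 by (apply pt_eq; simpl; ring). apply Hh. lra.
    - lra. }
  destruct (Hg 1 ltac:(lra)) as [e [He L]].
  set (d := Rmin e 1 / 2).
  assert (0 < d /\ d < e /\ d < 1).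
  { pose proof (Rmin_l e 1). pose proof (Rmin_r e 1).
    assert (0 < Rmin e 1) by (apply Rmin_glb_lt; lra). unfold d. lra. }
  destruct (L (1 - d)) as [r [R1 R2]]; [lra|rewrite Rabs_left; lra|].
  apply (Omega_rep _ (padd q (pscale (1 - d) v))) in R2; [|apply HO; lra|apply K; lra].
  apply HN. replace (padd q v) with r; [eapply rep_Dom; eauto|].
  apply (f_equal fst) in R2 as R3. apply (f_equal snd) in R2. simpl in *. apply pt_eq; simpl; lra.
Qed.

Lemma inner_vertex_not_Dom n : ~ Dom (sg (S (S n)), sg (S n)).
Proof.
  assert (Inj : forall i j, sg (S i) = sg (S j) -> i = j).
  { intros i j E. destruct (Nat.lt_trichotomy i j) as [G|[G|G]]; [|easy|].
    - sgm (S i) (S j). lra.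
    - sgm (S j) (S i). lra. }
  intros H. apply Dom_row in H as [m [H1 [H2 [H3 H4]]]]. simpl in *.
  destruct (Req_dec (sg (S n)) (sg (S m))) as [E|E].
  - specialize (H3 E). apply Inj in E. subst m. lra.
  - destruct (Req_dec (sg (S n)) (sg (S (S m)))) as [E'|E'].
    + specialize (H4 E'). apply Inj in E'. subst n. sgl (S m) (S (S (S m))). lra.
    + apply (sg_not_between (lam := lam) (S n) m).
      split; apply Rnot_le_lt; intro; [apply E|apply E']; lra.
Qed.

(* The kite with apex [(lim, lim)] bounded by the lines through the inner vertices. *)
Lemma kite_Omega p : 0 < fst p -> 0 < snd p ->
  lam * (lim - snd p) < lim - fst p -> lam * (lim - fst p) < lim - snd p -> Omega lam p.
Proof.
  pose proof (lam_pos (lam := lam)). pose proof (lam_lt (lam := lam)).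
  assert (K : forall x y, 0 < x -> 0 < y -> lam * (lim - y) < lim - x -> lam * (lim - x) < lim - y ->
    exists n, sg (S n) <= x < sg (S (S n)) /\ sg n < y).
  { intros x y H1 H2 H3 H4. destruct (interval_exists (lam := lam) x) as [n Hn].
    - split; [lra|]. assert (0 < (1 - lam * lam) * (lim - x)) by nra.
      apply Rnot_le_lt. intros L. assert (0 < 1 - lam * lam) by nra. nra.
    - exists n. split; [easy|]. destruct n as [|n]; [now rewrite sg_0|].
      pose proof (sg_lim_sub (lam := lam) n) as E1. pose proof (sg_lim_sub (lam := lam) (S n)) as E2.
      simpl in E2. apply Rmult_lt_reg_l with lam; [easy|]. 
      assert (lam * (lim - sg (S n)) = lim - sg (S (S n))) by (rewrite E1, E2; ring). lra. }
  intros H1 H2 H3 H4. apply Omega_iff. split; [apply (K (fst p) (snd p))|apply (K (snd p) (fst p))]; auto.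
Qed.

(* A direction of the kite's cone is no image of the horizontal: horizontally every point sees
   one-sided strips without singularities, but the inner vertices accumulate at the apex. *)
Lemma cone_direction (f g : X lam -> X lam) A q : affine_map f A -> (forall x, f (g x) = x) ->
  0 < mdet A -> a21 A <> 0 -> a11 A = q * a21 A -> lam < q -> lam * q < 1 -> False.
Proof.
  intros Hf Hfg Hdet Hy Hx Hq1 Hq2.
  pose proof (lam_pos (lam := lam)). pose proof (lam_lt (lam := lam)). pose proof (sg_lim_pos (lam := lam)) as HS.
  (* [b] lies on the ray from the apex in direction [-(q, 1)]. Both [rho < lim] and, by
     [lam * q < 1], [rho * q < lim] hold, so its coordinates are positive. *)
  set (rho := lim * lam / 2).
  assert (Hr : 0 < rho) by (unfold rho; nra).
  assert (Hr1 : rho < lim) by (unfold rho; nra).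
  assert (Hr2 : rho * q < lim) by (unfold rho; nra).
  set (b := (lim - rho * q, lim - rho)).
  assert (Hb : Omega lam b).
  { apply kite_Omega; unfold b; simpl; try lra; nra. }
  destruct (cl_exists (lam := lam) b (or_introl Hb)) as [x Hx0].
  destruct (straight_strip (g x)) as [h [Hh L]].
  (* The vector from [b] to the n-th inner vertex is a multiple of the first column of [A] minus
     [lam ^ n * lim * (lam, 1)]. Its preimage therefore has height [M * lam ^ n] up to sign, below
     [h] for large [n]. *)
  set (M := Rabs (a21 A) * lim * (q - lam) / mdet A).
  assert (HM : 0 < M).
  { unfold M. apply Rdiv_lt_0_compat; auto. apply Rmult_lt_0_compat; [|lra].
    apply Rmult_lt_0_compat; auto. now apply Rabs_pos_lt. }
  destruct (pow_lt_1_zero lam ltac:(rewrite Rabs_right; lra) (h / M) ltac:(now apply Rdiv_lt_0_compat)) as [n Hn].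
  specialize (Hn n (Nat.le_refl n)). rewrite Rabs_right in Hn by (left; apply lam_pow_pos).
  pose proof (lam_pow_pos (lam := lam) n) as Hp.
  set (v := psub (sg (S (S n)), sg (S n)) b).
  pose proof (sg_lim_sub (lam := lam) n) as E1. pose proof (sg_lim_sub (lam := lam) (S n)) as E2. simpl in E2.
  assert (Ev1 : fst v = rho * q - lam * lam ^ n * lim) by (unfold v, b; simpl; lra).
  assert (Ev2 : snd v = rho - lam ^ n * lim) by (unfold v, b; simpl; lra).
  assert (Evb : padd b v = (sg (S (S n)), sg (S n))) by (unfold v; apply pt_eq; simpl; lra).
  clearbody v.
  assert (Ew : snd (mapply (minv A) v) = - (a21 A) * (lam ^ n * lim * (q - lam)) / mdet A).
  { simpl. rewrite Ev1, Ev2, Hx. field. lra. }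
  assert (HK : 0 < lam ^ n * lim * (q - lam)) by (apply Rmult_lt_0_compat; [nra|lra]).
  destruct (L (mapply (minv A) v)) as [c [C1 C2]].
  - rewrite Ew. intros E. apply (f_equal (fun r => r * mdet A)) in E.
    unfold Rdiv in E. rewrite Rmult_assoc, Rinv_l, Rmult_0_l, Rmult_1_r in E by lra. nra.
  - rewrite Ew. unfold Rdiv. rewrite !Rabs_mult, Rabs_Ropp.
    rewrite (Rabs_right (/ mdet A)) by (left; now apply Rinv_0_lt_compat).
    rewrite (Rabs_right (lam ^ n)), (Rabs_right lim), (Rabs_right (q - lam)) by lra.
    apply (Rmult_lt_compat_r M) in Hn; auto. unfold M, Rdiv in *.
    replace (h * / (Rabs (a21 A) * lim * (q - lam) * / mdet A) * (Rabs (a21 A) * lim * (q - lam) * / mdet A)) with h in Hn.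
    + lra.
    + rewrite Rmult_assoc, Rinv_l; lra.
  - apply (straight_image f A) in C1; auto. rewrite mapply_minv in C1 by lra.
    eapply (no_path_to_vertex x b v); eauto.
    + intros t Ht.
      assert (0 <= t * (lim * lam ^ n)) by (apply Rmult_le_pos; nra).
      assert (F1 : lim - fst (padd b (pscale t v)) = (1 - t) * (rho * q) + t * (lam * lam ^ n * lim)).
      { cbn [padd pscale fst snd]. rewrite Ev1. unfold b. simpl. ring. }
      assert (F2 : lim - snd (padd b (pscale t v)) = (1 - t) * rho + t * (lam ^ n * lim)).
      { cbn [padd pscale fst snd]. rewrite Ev2. unfold b. simpl. ring. }
      assert (P1 : lam ^ n <= 1).
      { clear - H H0 Hlam. induction n; simpl; [lra|]. pose proof (lam_pow_pos (lam := lam) n). nra. }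
      assert (P2 : lam ^ n * lim <= lim) by nra.
      assert (P3 : lam * lam ^ n * lim <= lim) by nra.
      apply kite_Omega.
      * assert (lim - fst (padd b (pscale t v)) < lim); [rewrite F1|lra]. nra.
      * assert (lim - snd (padd b (pscale t v)) < lim); [rewrite F2|lra]. nra.
      * rewrite F1, F2. assert (0 < (1 - t) * rho) by nra. nra.
      * rewrite F1, F2. assert (0 < (1 - t) * rho) by nra.
        assert (t * (lam * lam ^ n * lim) <= t * (lam ^ n * lim)) by (apply Rmult_le_compat_l; nra).
        assert (0 <= t * (lam * lam ^ n * lim)) by (apply Rmult_le_pos; nra). nra.
    + rewrite Evb. apply inner_vertex_not_Dom.
    + simpl. now rewrite C2.
Qed.

Lemma above_push i (x : X lam) : above i x -> exists e, 0 < e /\ forall w z, small e w -> 0 < snd w ->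
  disp x w z -> inside i z.
Proof.
  intros [p [H1 H2]]. destruct (disp_cyl _ _ _ H1) as [e [He L]].
  two_small e (sg (S (S i)) - snd p). intros w z Hw Hs Hz. pose proof (proj1 (small_iff _ _) Hw).
  exists (padd p w). split; [|simpl; lra]. apply L; auto; [|lra]. now apply small_le with (2 := Hw).
Qed.

Lemma below_push i (x : X lam) : below i x -> exists e, 0 < e /\ forall w z, small e w -> snd w < 0 ->
  disp x w z -> inside i z.
Proof.
  intros [p [H1 H2]]. destruct (disp_cyl _ _ _ H1) as [e [He L]].
  two_small e (snd p - sg (S i)). intros w z Hw Hs Hz. pose proof (proj1 (small_iff _ _) Hw).
  exists (padd p w). split; [|simpl; lra]. apply L; auto; [|lra]. now apply small_le with (2 := Hw).
Qed.

(** The image of a point at mid-height may lie on a horizontal boundary. A small vertical push of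
    the image, pulled back by [minv A], moves it inside a cylinder, where horizontal geodesics close
    up. *)
Lemma generic_point (f : X lam -> X lam) A i e : affine_map f A -> mdet A <> 0 -> 0 < e -> e <= (sg (S (S i)) - sg (S i)) / 2 ->
  exists p x j, cyl i p x /\ Rabs (snd p - (sg (S i) + sg (S (S i))) / 2) < e /\ inside j (f x).
Proof.
  intros Hf HA He Hi. pose proof (sg_lt_S (lam := lam) i).
  set (p0 := (0, (sg (S i) + sg (S (S i))) / 2)).
  destruct (cyl_exists i p0) as [x0 Hx0]; [unfold p0; simpl; lra|].
  destruct (cyl_open _ _ _ Hx0) as [e1 [He1 L1]], (Hf x0) as [e2 [He2 L2]].
  destruct (above_exists (f x0)) as [j Hj]. destruct (above_push _ _ Hj) as [e3 [He3 L3]].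
  set (d := Rmin e1 (Rmin e2 e)).
  assert (Hd : 0 < d /\ d <= e1 /\ d <= e2 /\ d <= e).
  { pose proof (Rmin_l e1 (Rmin e2 e)). pose proof (Rmin_r e1 (Rmin e2 e)).
    pose proof (Rmin_l e2 e). pose proof (Rmin_r e2 e).
    assert (0 < d) by (repeat apply Rmin_glb_lt; auto). unfold d in *. lra. }
  clearbody d.
  destruct (small_mapply (minv A) d) as [e4 [He4 L4]]; [easy|].
  set (eta := Rmin e3 e4 / 2).
  assert (Heta : 0 < eta /\ eta < e3 /\ eta < e4).
  { pose proof (Rmin_l e3 e4). pose proof (Rmin_r e3 e4).
    assert (0 < Rmin e3 e4) by (apply Rmin_glb_lt; auto). unfold eta. lra. }
  clearbody eta.
  set (w := mapply (minv A) (0, eta)).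
  assert (Hw : small d w). { apply L4. apply small_iff. simpl. lra. }
  assert (Ew : mapply A w = (0, eta)) by now apply mapply_minv.
  clearbody w. pose proof (proj1 (small_iff _ _) Hw) as Hw'.
  destruct (L1 w) as [x [Hx Dx]]; [now apply small_le with (2 := Hw)|unfold p0; simpl; lra|].
  exists (padd p0 w), x, j. split; [easy|]. split.
  - simpl. replace ((sg (S i) + sg (S (S i))) / 2 + snd w - (sg (S i) + sg (S (S i))) / 2) with (snd w) by ring.
    destruct Hw. lra.
  - apply (L3 (mapply A w)).
    + rewrite Ew. apply small_iff. simpl. lra.
    + rewrite Ew. simpl. lra.
    + apply L2; auto. now apply small_le with (2 := Hw).
Qed.

(* Otherwise a horizontal geodesic stays in the image of the 0-th cylinder until it closes up. *)
Lemma height_bounded_below (f g : X lam -> X lam) A : affine_map f A -> (forall x, g (f x) = x) ->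
  0 < mdet A -> a21 A <> 0 -> mdet A <= 4 * circ 1 * Rabs (a21 A).
Proof.
  intros Hf Hgf HA Hy. apply Rnot_lt_le. intros Hlt.
  destruct (generic_point f A 0 (1 / 4)) as [p [x [i [Hx [Hp [r [Hr1 Hr2]]]]]]]; auto; try lra.
  { rewrite sg_1, sg_2. lra. }
  rewrite sg_1, sg_2 in Hp. apply Rabs_def2 in Hp.
  set (w := mapply (minv A) (1, 0)).
  assert (Ew : snd w = - a21 A / mdet A) by (unfold w; simpl; field; lra).
  assert (EA : mapply A w = (1, 0)) by (apply mapply_minv; lra).
  pose proof (circ_pos (lam := lam) i) as Hc. pose proof (circ_le_1 (lam := lam) i) as Hc1.
  (* Cylinder 0 has height 1 and the start lies within 1/4 of its middle, so a drift below 1/4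
     during one full turn keeps the preimage inside. This is the origin of the factor 4. *)
  assert (Hw : Rabs (circ i * snd w) < 1 / 4).
  { rewrite Ew. rewrite Rabs_mult. unfold Rdiv. rewrite Rabs_mult, Rabs_Ropp.
    rewrite (Rabs_right (circ i)) by lra.
    rewrite (Rabs_right (/ mdet A)) by (left; now apply Rinv_0_lt_compat).
    apply Rmult_lt_reg_r with (mdet A); auto.
    replace (circ i * (Rabs (a21 A) * / mdet A) * mdet A) with (circ i * Rabs (a21 A)) by (field; lra).
    pose proof (Rabs_pos (a21 A)). nra. }
  apply Rabs_def2 in Hw.
  destruct (cyl_path_interior 0 p x w (circ i)) as [c [C0 C1]]; auto.
  { intros t Ht. rewrite sg_1, sg_2.
    assert (t / circ i * (circ i * snd w) = t * snd w) by (field; lra).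
    assert (0 <= t / circ i <= 1).
    { split.
      - apply Rmult_le_pos; [lra|]. left. now apply Rinv_0_lt_compat.
      - apply Rmult_le_reg_r with (circ i); auto. unfold Rdiv. rewrite Rmult_assoc, Rinv_l; lra. }
    nra. }
  destruct (cyl_path_interior i r (f x) (1, 0) (circ i)) as [c' [C0' C1']]; auto.
  { intros t Ht. simpl. lra. }
  assert (E : f (c (circ i)) = c' (circ i)).
  { apply (straight_unique (circ i) (1, 0) (fun t => f (c t)) c'); try lra.
    - rewrite <- EA. apply straight_image; auto. eapply straight_cyl; eauto.
    - eapply straight_cyl; eauto.
    - now rewrite C0, C0'. }
  assert (E' : c' (circ i) = f x).
  { apply cyl_fun with (m := i) (p := padd r (pscale (circ i) (1, 0))); [apply C1'; lra|].
    apply cyl_shift with (z := 1%Z) in Hr1.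
    replace (padd r (pscale (circ i) (1, 0))) with (fst r + 1 * circ i, snd r); auto.
    apply pt_eq; simpl; ring. }
  rewrite E' in E. assert (E2 : c (circ i) = x) by (rewrite <- (Hgf x), <- E, Hgf; auto).
  pose proof (C1 (circ i) ltac:(lra)) as C2. rewrite E2 in C2.
  destruct (cyl_inj _ _ _ _ Hx C2) as [E3 _]. simpl in E3.
  assert (snd w = 0) by nra. rewrite Ew in H.
  apply Hy. apply (f_equal (fun u => u * mdet A)) in H. unfold Rdiv in H.
  rewrite Rmult_assoc, Rinv_l in H; lra.
Qed.
End Directions.

(** * Affine maps preserving the horizontal direction *)

Section Horizontal.
Context {lam : R} {Hlam : ladder_ratio lam}.
Local Notation sg := (lsum lam).
Local Notation circ := (circum lam).
Local Notation Dom := (Dom lam).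
Local Notation row := (@row lam).
Local Notation cyl := (@cyl lam).
Local Notation rep := (@rep lam).

Lemma inside_unique i j (x : X lam) : inside i x -> inside j x -> i = j.
Proof.
  intros [p [H1 H2]] [q [H3 H4]]. symmetry. eapply cyl_interior_unique; eauto.
Qed.

Lemma push_exists (x : X lam) e w : 0 < e -> exists t y, 0 < t /\ small e (pscale t w) /\ disp x (pscale t w) y.
Proof.
  intros He. destruct (disp_open x) as [d [Hd L]].
  destruct (small_pscale (Rmin e d) w) as [t [Ht L']]; [now apply Rmin_glb_lt|].
  assert (Hs : small (Rmin e d) (pscale (t / 2) w)) by (apply L'; rewrite Rabs_right; lra).
  destruct (L (pscale (t / 2) w)) as [y Hy]; [apply small_le with (2 := Hs), Rmin_r|].
  exists (t / 2), y. split; [lra|]. split; [|easy]. apply small_le with (2 := Hs), Rmin_l.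
Qed.

Lemma below_unique i j (x : X lam) : below i x -> below j x -> i = j.
Proof.
  intros H1 H2. destruct (below_push _ _ H1) as [e1 [He1 L1]], (below_push _ _ H2) as [e2 [He2 L2]].
  destruct (push_exists x (Rmin e1 e2) (0, -1)) as [t [y [Ht [Hs Hy]]]]; [now apply Rmin_glb_lt|].
  apply (inside_unique i j y); [apply (L1 (pscale t (0, -1)))|apply (L2 (pscale t (0, -1)))]; auto;
    try (simpl; lra); apply small_le with (2 := Hs); [apply Rmin_l|apply Rmin_r].
Qed.

Lemma above_bottom i j (x : X lam) : above i x -> below j x -> i <> j ->
  exists u, row i (u, sg (S i)) /\ rep x (u, sg (S i)).
Proof.
  intros [p [H1 H2]] Hj N.
  destruct (Req_dec (snd p) (sg (S i))) as [E|E].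
  - destruct H1 as [z [R1 R2]]. rewrite E in R1, R2. eauto.
  - exfalso. apply N. apply (below_unique i j x); auto. exists p. split; [easy|]. 
    destruct H2 as [[?|?] ?]; lra.
Qed.

(** Of the two saddle connections on the bottom of cylinder 1, the other one has cylinder 3 below
    it. *)
Lemma arc_above_1 (x : X lam) : above 1 x -> below 0 x -> exists u, sg 1 < u < sg 3 /\ rep x (u, sg 2).
Proof.
  intros H1 H2. destruct (above_bottom 1 0 x H1 H2 ltac:(lia)) as [u [R1 R2]].
  destruct (bottom_cases 1 u x R1 R2) as [[j [Ej [Hu Hj]]]|[[Ej _]|[Hu Hj]]].
  - exists u. auto.
  - discriminate.
  - exfalso. assert (B : below 3 x).
    { exists (u, sg 5). split; auto. simpl. pose proof (sg_lt_S (lam := lam) 3). lra. }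
    pose proof (below_unique 3 0 x B H2). discriminate.
Qed.

Lemma arc_above_0 (x : X lam) : above 0 x -> below 1 x -> exists u, sg 1 < u < sg 2 /\ rep x (u, sg 1).
Proof.
  intros H1 H2. destruct (above_bottom 0 1 x H1 H2 ltac:(lia)) as [u [R1 R2]].
  destruct (bottom_cases 0 u x R1 R2) as [[j [Ej [Hu Hj]]]|[[Ej [Hu Hj]]|[Hu Hj]]].
  - discriminate.
  - exists u. auto.
  - exfalso. assert (B : below 2 x).
    { exists (u, sg 4). split; auto. simpl. pose proof (sg_lt_S (lam := lam) 2). lra. }
    pose proof (below_unique 2 1 x B H2). discriminate.
Qed.

(** The bottom of cylinder 2 borders only cylinders 1 and 4. *)
Lemma above_2_below_0 (x : X lam) : above 2 x -> below 0 x -> False.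
Proof.
  intros H1 H2. destruct (above_bottom 2 0 x H1 H2 ltac:(lia)) as [u [R1 R2]].
  destruct (bottom_cases 2 u x R1 R2) as [[j [Ej [Hu Hj]]]|[[Ej [Hu Hj]]|[Hu Hj]]].
  - injection Ej as <-. assert (B : below 1 x).
    { exists (u, sg 3). split; auto. simpl. pose proof (sg_lt_S (lam := lam) 1). lra. }
    pose proof (below_unique 1 0 x B H2). discriminate.
  - discriminate.
  - assert (B : below 4 x).
    { exists (u, sg 6). split; auto. simpl. pose proof (sg_lt_S (lam := lam) 4). lra. }
    pose proof (below_unique 4 0 x B H2). discriminate.
Qed.

Lemma arc_row_1 u (x : X lam) : sg 1 < u < sg 3 -> rep x (u, sg 2) -> above 1 x /\ below 0 x.
Proof.
  intros H Hx. pose proof (sg_lt_S (lam := lam) 1). pose proof (sg_lt_S (lam := lam) 0).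
  pose proof (sg_lt_S (lam := lam) 2). rewrite sg_1 in *.
  split; exists (u, sg 2); (split; [apply cyl_row; auto; unfold_row; simpl; rewrite ?sg_0, ?sg_1|simpl; rewrite ?sg_1; lra]).
  - repeat split; intros; lra.
  - repeat split; intros; lra.
Qed.

Lemma arc_row_0 u (x : X lam) : sg 1 < u < sg 2 -> rep x (u, sg 1) -> above 0 x /\ below 1 x.
Proof.
  intros H Hx. pose proof (sg_lt_S (lam := lam) 1). pose proof (sg_lt_S (lam := lam) 0).
  assert (Hr : row 0 (u, sg 1)).
  { unfold_row. simpl. rewrite sg_0, sg_1 in *. repeat split; intros; lra. }
  split.
  - exists (u, sg 1). split; [now apply cyl_row|simpl; lra].
  - destruct (bottom_cases 0 u x Hr Hx) as [[j [Ej _]]|[[_ [_ Hj]]|[Hu _]]]; [discriminate| |lra].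
    exists (u, sg 3). split; [easy|simpl; lra].
Qed.

Lemma rep_same_height (x : X lam) j u v : rep x (u, sg j) -> rep x (v, sg j) -> u = v.
Proof.
  intros H1 H2. rewrite (rep_eqv x _ _ H1) in H2.
  assert (K : forall u v, ~ glue lam (u, sg j) (v, sg j)).
  { intros a b G. apply glue_iff in G as [[n [[G1 G2] G3]]|[n [[G1 G2] G3]]]; simpl in *.
    - injection G3 as _ G3. sgm n (S (S (S n))). lra.
    - now apply sg_not_between in G1. }
  destruct H2 as [E|[E|E]]; [congruence| |]; now apply K in E.
Qed.

(** The inverse and its matrix are bundled so that each inequality can also be applied to [g]. *)
Definition horizontal_pair (f g : X lam -> X lam) (a b d : R) : Prop :=
  affine_map f (mkMat a b 0 d) /\ affine_map g (mkMat (/ a) (- (b / (a * d))) 0 (/ d)) /\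
  (forall x, g (f x) = x) /\ (forall x, f (g x) = x) /\ 0 < a * d.

Lemma horizontal_pair_sym f g a b d : horizontal_pair f g a b d ->
  horizontal_pair g f (/ a) (- (b / (a * d))) (/ d).
Proof.
  intros [H1 [H2 [H3 [H4 H5]]]]. assert (a <> 0) by nra. assert (d <> 0) by nra.
  split; [exact H2|]. split.
  - replace (mkMat (/ / a) (- (- (b / (a * d)) / (/ a * / d))) 0 (/ / d)) with (mkMat a b 0 d); auto.
    f_equal; field; auto.
  - repeat split; auto. rewrite <- Rinv_mult. now apply Rinv_0_lt_compat.
Qed.

(** The closed horizontal geodesic through [x] is mapped to a closed one through [f x], whose signed
    length is [a * circ i]. *)
Lemma period_multiple f g a b d i j x : horizontal_pair f g a b d ->
  inside i x -> inside j (f x) -> exists N, a * circ i = IZR N * circ j.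
Proof.
  intros [Hf _] [p [Hp1 Hp2]] [q [Hq1 Hq2]].
  pose proof (circ_pos (lam := lam) i) as Hc.
  destruct (cyl_path_interior i p x (1, 0) (circ i)) as [c [C0 C1]]; auto.
  { intros t Ht. simpl. lra. }
  destruct (cyl_path_interior j q (f x) (a, 0) (circ i)) as [c' [C0' C1']]; auto.
  { intros t Ht. simpl. lra. }
  assert (E1 : c (circ i) = x).
  { apply cyl_fun with (m := i) (p := padd p (pscale (circ i) (1, 0))); [apply C1; lra|].
    apply cyl_shift with (z := 1%Z) in Hp1.
    replace (padd p (pscale (circ i) (1, 0))) with (fst p + 1 * circ i, snd p); auto.
    apply pt_eq; simpl; ring. }
  assert (E2 : f (c (circ i)) = c' (circ i)).
  { apply (straight_unique (circ i) (a, 0) (fun t => f (c t)) c'); try lra.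
    - replace (a, 0) with (mapply (mkMat a b 0 d) (1, 0)) by (apply pt_eq; simpl; ring).
      apply straight_image; auto. eapply straight_cyl; eauto.
    - eapply straight_cyl; eauto.
    - now rewrite C0, C0'. }
  rewrite E1 in E2. pose proof (C1' (circ i) ltac:(lra)) as Hq3. rewrite <- E2 in Hq3.
  destruct (cyl_inj _ _ _ _ Hq1 Hq3) as [_ [N HN]]. exists N. simpl in HN. lra.
Qed.

Lemma abs_multiple_ge a c c' N : 0 < c -> 0 < c' -> a <> 0 -> a * c = IZR N * c' -> c' <= Rabs a * c.
Proof.
  intros Hc Hc' Ha E.
  assert (N <> 0%Z) by (intros ->; nra).
  assert (1 <= Rabs (IZR N)).
  { rewrite <- abs_IZR. apply IZR_le. lia. }
  assert (Rabs a * c = Rabs (IZR N) * c').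
  { rewrite <- (Rabs_right c) at 1 by lra. rewrite <- (Rabs_right c') by lra. rewrite <- !Rabs_mult. congruence. }
  nra.
Qed.

Lemma circ_scaled f g a b d i j x : horizontal_pair f g a b d ->
  inside i x -> inside j (f x) -> Rabs a * circ i = circ j.
Proof.
  intros H Hi Hj. destruct (period_multiple _ _ _ _ _ _ _ _ H Hi Hj) as [N HN].
  pose proof (horizontal_pair_sym _ _ _ _ _ H) as H'. destruct H as [_ [_ [Hgf [_ Had]]]].
  assert (Ha : a <> 0) by nra.
  destruct (period_multiple _ _ _ _ _ j i (f x) H' Hj) as [M HM]; [now rewrite Hgf|].
  pose proof (circ_pos (lam := lam) i). pose proof (circ_pos (lam := lam) j).
  apply abs_multiple_ge in HN; auto. apply abs_multiple_ge in HM; auto; [|now apply Rinv_neq_0_compat].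
  rewrite Rabs_inv in HM. pose proof (Rabs_pos_lt a Ha).
  apply (Rmult_le_compat_l (Rabs a)) in HM; [|lra].
  rewrite <- Rmult_assoc, Rinv_r in HM by lra. lra.
Qed.

(** Cylinder 1 has the largest circumference, so its image shows [|a| <= 1]; the inverse gives the
    converse. *)
Lemma horizontal_isometry f g a b d : horizontal_pair f g a b d -> Rabs a = 1.
Proof.
  assert (K : forall f g a b d, horizontal_pair f g a b d -> Rabs a <= 1).
  { clear - Hlam. intros f g a b d H. pose proof H as [Hf [_ [_ [_ Had]]]].
    pose proof (sg_lt_S (lam := lam) 1).
    destruct (generic_point f (mkMat a b 0 d) 1 ((sg 3 - sg 2) / 2)) as [p [x [j [H1 [H2 H3]]]]];
      auto; [unfold mdet; simpl; lra|lra|lra|].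
    apply Rabs_def2 in H2.
    assert (Hi : inside 1 x) by (exists p; split; [easy|lra]).
    pose proof (circ_scaled _ _ _ _ _ _ _ _ H Hi H3).
    pose proof (circ_le_1 (lam := lam) j). pose proof (circ_pos (lam := lam) 1). nra. }
  intros H. pose proof (K _ _ _ _ _ H) as K1. pose proof H as [_ [_ [_ [_ Had]]]].
  apply horizontal_pair_sym, K in H. assert (Ha : a <> 0) by nra.
  rewrite Rabs_inv in H. pose proof (Rabs_pos_lt a Ha).
  apply (Rmult_le_compat_l (Rabs a)) in H; [|lra]. rewrite Rinv_r in H; lra.
Qed.

(* Horizontal cylinders are told apart by their circumferences. *)
Lemma inside_preserved f g a b d i j x : horizontal_pair f g a b d ->
  inside i x -> inside j (f x) -> i = j.
Proof.
  intros H Hi Hj. pose proof (circ_scaled _ _ _ _ _ _ _ _ H Hi Hj) as E.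
  rewrite (horizontal_isometry _ _ _ _ _ H) in E. apply (circ_inj (lam := lam)). lra.
Qed.

(** [sd] is the sign of the side of [x] under consideration; its image is the side of sign [sd * d].
    A slight push to that side lands inside cylinders, where [inside_preserved] applies. *)
Lemma side_image f g a b d sd i j x : horizontal_pair f g a b d -> sd <> 0 ->
  (exists e, 0 < e /\ forall w z, small e w -> 0 < sd * snd w -> disp x w z -> inside i z) ->
  (exists e, 0 < e /\ forall w z, small e w -> 0 < sd * d * snd w -> disp (f x) w z -> inside j z) ->
  i = j.
Proof.
  intros H Hs [e1 [He1 L1]] [e2 [He2 L2]]. pose proof H as [Hf [_ [_ [_ Had]]]].
  destruct (Hf x) as [e3 [He3 L3]].
  destruct (small_mapply (mkMat a b 0 d) e2 He2) as [e4 [He4 L4]].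
  destruct (push_exists x (Rmin e1 (Rmin e3 e4)) (0, sd)) as [t [y [Ht [Hsm Hy]]]]; [repeat apply Rmin_glb_lt; auto|].
  pose proof (Rmin_l e1 (Rmin e3 e4)). pose proof (Rmin_r e1 (Rmin e3 e4)).
  pose proof (Rmin_l e3 e4). pose proof (Rmin_r e3 e4).
  assert (Hd : d <> 0) by nra. assert (0 < sd * sd) by nra. assert (0 < d * d) by nra.
  apply (inside_preserved f g a b d i j y H).
  - apply (L1 (pscale t (0, sd))); auto; [now apply small_le with (2 := Hsm)|simpl; nra].
  - apply (L2 (mapply (mkMat a b 0 d) (pscale t (0, sd)))).
    + apply L4. apply small_le with (2 := Hsm). lra.
    + simpl. replace (sd * d * (0 * (t * 0) + d * (t * sd))) with ((sd * sd) * (d * d) * t) by ring.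
      apply Rmult_lt_0_compat; nra.
    + apply L3; auto. apply small_le with (2 := Hsm). lra.
Qed.

Lemma above_image f g a b d i x : horizontal_pair f g a b d -> above i x ->
  (0 < d -> above i (f x)) /\ (d < 0 -> below i (f x)).
Proof.
  intros H Hi. destruct (above_push _ _ Hi) as [e [He L]]. split; intros Hd.
  - destruct (above_exists (f x)) as [j Hj]. replace i with j; auto.
    symmetry. apply (side_image f g a b d 1 i j x H); [lra| |].
    + exists e. split; auto. intros w z ? ?. apply L; auto. lra.
    + destruct (above_push _ _ Hj) as [e' [He' L']]. exists e'. split; auto.
      intros w z ? ?. apply L'; auto. nra.
  - destruct (below_exists (f x)) as [j Hj]. replace i with j; auto.
    symmetry. apply (side_image f g a b d 1 i j x H); [lra| |].
    + exists e. split; auto. intros w z ? ?. apply L; auto. lra.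
    + destruct (below_push _ _ Hj) as [e' [He' L']]. exists e'. split; auto.
      intros w z ? ?. apply L'; auto. nra.
Qed.

Lemma below_image f g a b d i x : horizontal_pair f g a b d -> below i x ->
  (0 < d -> below i (f x)) /\ (d < 0 -> above i (f x)).
Proof.
  intros H Hi. destruct (below_push _ _ Hi) as [e [He L]]. split; intros Hd.
  - destruct (below_exists (f x)) as [j Hj]. replace i with j; auto.
    symmetry. apply (side_image f g a b d (-1) i j x H); [lra| |].
    + exists e. split; auto. intros w z ? ?. apply L; auto. lra.
    + destruct (below_push _ _ Hj) as [e' [He' L']]. exists e'. split; auto.
      intros w z ? ?. apply L'; auto. nra.
  - destruct (above_exists (f x)) as [j Hj]. replace i with j; auto.
    symmetry. apply (side_image f g a b d (-1) i j x H); [lra| |].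
    + exists e. split; auto. intros w z ? ?. apply L; auto. lra.
    + destruct (above_push _ _ Hj) as [e' [He' L']]. exists e'. split; auto.
      intros w z ? ?. apply L'; auto. nra.
Qed.

(* A saddle connection below the 0-th and above the 2-nd cylinder exists, one the other way round does not. *)
Lemma horizontal_orientation f g a b d : horizontal_pair f g a b d -> a = 1 /\ 0 < d.
Proof.
  intros H. pose proof (horizontal_isometry _ _ _ _ _ H) as Ha.
  assert (Hd : 0 < d).
  { pose proof H as [_ [_ [_ [_ Had]]]]. apply Rnot_le_lt. intros L.
    assert (d < 0) by (destruct L as [?|E]; [easy|rewrite E in Had; lra]).
    assert (M : sg 2 < sg 3) by apply sg_lt_S. pose proof (sg_lt_S (lam := lam) 0).
    assert (Hr : row 0 ((sg 2 + sg 3) / 2, sg 1)).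
    { unfold_row. simpl. rewrite sg_0, sg_1 in *. repeat split; intros; lra. }
    destruct (cl_exists _ (row_Dom _ _ Hr)) as [x Hx].
    assert (A0 : above 0 x).
    { exists ((sg 2 + sg 3) / 2, sg 1). split; [now apply cyl_row|simpl; lra]. }
    assert (B2 : below 2 x).
    { destruct (bottom_cases 0 _ x Hr Hx) as [[j [Ej _]]|[[_ [Hu _]]|[_ Hj]]]; [discriminate|lra|].
      exists ((sg 2 + sg 3) / 2, sg 4). split; auto. simpl. pose proof (sg_lt_S (lam := lam) 2). lra. }
    apply (above_2_below_0 (f x)).
    - now apply (proj2 (below_image _ _ _ _ _ _ _ H B2)).
    - now apply (proj2 (above_image _ _ _ _ _ _ _ H A0)). }
  split; auto. destruct H as [_ [_ [_ [_ Had]]]].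
  rewrite Rabs_right in Ha; [easy|]. nra.
Qed.

(* Otherwise an interior point of the arc would be pushed onto its right end, a vertex. *)
Lemma arc_not_right f b d al be j u v (x : X lam) :
  affine_map f (mkMat 1 b 0 d) ->
  (forall w, al < w < be -> Dom (w, sg j)) ->
  (forall w y, al < w < be -> rep y (w, sg j) -> exists w', al < w' < be /\ rep (f y) (w', sg j)) ->
  al < u < be -> rep x (u, sg j) -> rep (f x) (v, sg j) -> al < v < be -> v <= u.
Proof.
  intros Hf HD Hpres Hu Hx Hv Hv'. apply Rnot_lt_le. intros Huv.
  assert (P : forall u0 s, exists y : X lam, al < u0 + s < be -> rep y (u0 + s, sg j)).
  { intros u0 s. destruct (classic (al < u0 + s < be)) as [N|N]; [|exists x; intros; contradiction].
    destruct (cl_exists _ (HD _ N)) as [y Hy]. eauto. }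
  destruct (choice _ (P u)) as [c Hc], (choice _ (P v)) as [c' Hc'].
  assert (S : forall u0 T h, (forall s, al < u0 + s < be -> rep (h s) (u0 + s, sg j)) ->
    al < u0 -> u0 + T < be -> straight T (1, 0) h).
  { intros u0 T h Hh H1 H2 t Ht. exists 1. split; [lra|]. intros t' Ht' _.
    exists (u0 + t, sg j). split; [apply Hh; lra|].
    replace (padd (u0 + t, sg j) (pscale (t' - t) (1, 0))) with (u0 + t', sg j)
      by (apply pt_eq; simpl; ring). apply Hh. lra. }
  (* At time [T] the path started at [v] reaches the right end, while the path started at [u < v] is
     still inside the arc. *)
  set (T := be - v).
  assert (Sf : straight T (1, 0) (fun t => f (c t))).
  { replace (1, 0) with (mapply (mkMat 1 b 0 d) (1, 0)) by (apply pt_eq; simpl; ring).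
    apply straight_image; auto. apply (S u); auto; unfold T; lra. }
  assert (E : forall t, 0 <= t < T -> rep (f (c t)) (v + t, sg j)).
  { intros t Ht. rewrite (straight_unique t (1, 0) (fun t => f (c t)) c'); try lra.
    - apply Hc'. unfold T in Ht. lra.
    - eapply straight_restrict; eauto. lra.
    - apply (S v); auto; unfold T in Ht; lra.
    - apply rep_unique with (v, sg j).
      + rewrite (rep_unique (c 0) x (u, sg j)); auto.
        specialize (Hc 0). rewrite Rplus_0_r in Hc. auto.
      + specialize (Hc' 0). rewrite Rplus_0_r in Hc'. auto. }
  destruct (Hpres (u + T) (c T)) as [w' [Hw' Hw]]; [unfold T; lra|apply Hc; unfold T; lra|].
  destruct (Sf T) as [e1 [He1 L1]]; [unfold T; lra|].
  destruct (disp_fun_local (f (c T))) as [e2 [He2 L2]].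
  set (eta := Rmin (Rmin e1 e2) (Rmin (w' - al) T) / 2).
  assert (Heta : 0 < eta /\ eta < e1 /\ eta < e2 /\ eta < w' - al /\ eta < T).
  { pose proof (Rmin_l (Rmin e1 e2) (Rmin (w' - al) T)). pose proof (Rmin_r (Rmin e1 e2) (Rmin (w' - al) T)).
    pose proof (Rmin_l e1 e2). pose proof (Rmin_r e1 e2).
    pose proof (Rmin_l (w' - al) T). pose proof (Rmin_r (w' - al) T).
    assert (0 < Rmin (Rmin e1 e2) (Rmin (w' - al) T)) by (repeat apply Rmin_glb_lt; unfold T; lra).
    unfold eta. lra. }
  clearbody eta.
  destruct (cl_exists (lam := lam) (w' - eta, sg j)) as [y Hy]; [apply HD; lra|].
  assert (Ey : y = f (c (T - eta))).
  { apply (L2 (pscale (T - eta - T) (1, 0))).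
    - apply small_iff. simpl. lra.
    - exists (w', sg j). split; auto.
      replace (padd (w', sg j) (pscale (T - eta - T) (1, 0))) with (w' - eta, sg j); auto.
      apply pt_eq; simpl; ring.
    - apply L1; [lra|]. rewrite Rabs_left; lra. }
  subst y. pose proof (rep_same_height _ _ _ _ Hy (E (T - eta) ltac:(lra))). unfold T in *. lra.
Qed.

(** [Q] is meant to describe the arc by its two adjacent cylinders, so that both maps preserve it.
    Neither map moves a point to the right, hence neither moves it at all. *)
Lemma arc_fixed f g b d al be j (Q : X lam -> Prop) u x : horizontal_pair f g 1 b d ->
  (forall w, al < w < be -> Dom (w, sg j)) ->
  (forall y, Q y <-> exists w, al < w < be /\ rep y (w, sg j)) ->
  (forall y, Q y -> Q (f y)) -> (forall y, Q y -> Q (g y)) ->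
  al < u < be -> rep x (u, sg j) -> f x = x.
Proof.
  intros H HD HQ Hf Hg Hu Hx.
  assert (Qx : Q x) by (apply HQ; eauto).
  destruct (proj1 (HQ (f x)) (Hf _ Qx)) as [v [Hv Hfx]].
  assert (Pf : forall w y, al < w < be -> rep y (w, sg j) -> exists w', al < w' < be /\ rep (f y) (w', sg j)).
  { intros w y Hw Hy. apply HQ, Hf, HQ. eauto. }
  assert (Pg : forall w y, al < w < be -> rep y (w, sg j) -> exists w', al < w' < be /\ rep (g y) (w', sg j)).
  { intros w y Hw Hy. apply HQ, Hg, HQ. eauto. }
  destruct H as [A1 [A2 [A3 [A4 A5]]]]. rewrite Rinv_1 in A2.
  assert (v <= u) by exact (arc_not_right f b d al be j u v x A1 HD Pf Hu Hx Hfx Hv).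
  assert (u <= v).
  { refine (arc_not_right g _ _ al be j v u (f x) A2 HD Pg Hv Hfx _ Hu). now rewrite A3. }
  apply rep_unique with (u, sg j); auto. replace u with v at 1 by lra. auto.
Qed.

(** A vertical segment crosses cylinder 1 between two fixed points, [B] on its bottom and [Tp] on
    its top. Its image joins the same points, which forces [d = 1] and makes the horizontal shift
    [b * lam] a multiple of the circumference. *)
Lemma horizontal_shear f g a b d : horizontal_pair f g a b d ->
  a = 1 /\ d = 1 /\ exists N, b * lam = IZR N * circ 1.
Proof.
  intros H. destruct (horizontal_orientation _ _ _ _ _ H) as [-> Hd]. split; auto.
  pose proof (lam_pos (lam := lam)).
  assert (M3 : sg 2 < sg 3) by apply sg_lt_S.
  (* Any abscissa below both the bottom arc [(sg 1, sg 3)] and the top arc [(sg 1, sg 2)] of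
     cylinder 1 in the sense of lying in both intervals would serve. *)
  set (u := 1 / 2).
  assert (Hu : sg 1 < u < sg 2) by (rewrite sg_1, sg_2; unfold u; lra).
  assert (R1 : row 1 (u, sg 2)).
  { unfold_row. simpl. assert (sg 3 < sg 4) by apply sg_lt_S. repeat split; intros; lra. }
  assert (R2 : row 1 (u, sg 3)).
  { unfold_row. simpl. assert (sg 3 < sg 4) by apply sg_lt_S. repeat split; intros; lra. }
  destruct (cl_exists _ (row_Dom _ _ R1)) as [B HB], (cl_exists _ (row_Dom _ _ R2)) as [Tp HT].
  assert (HT' : rep Tp (u, sg 1)).
  { rewrite (rep_eqv Tp _ _ HT). right; right. apply glue_iff. left. exists 0%nat. unfold_edges.
    simpl. rewrite sg_0, sg_1 in *. auto. }
  assert (CB : cyl 1 (u, sg 2) B) by now apply cyl_row.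
  assert (CT : cyl 1 (u, sg 3) Tp) by now apply cyl_row.
  assert (FIX : forall f g b d, horizontal_pair f g 1 b d -> 0 < d -> f B = B /\ f Tp = Tp).
  { clear - Hlam Hu M3 HB HT'. intros f g b d H Hd.
    pose proof (horizontal_pair_sym _ _ _ _ _ H) as H'. rewrite Rinv_1 in H'.
    assert (Hd' : 0 < / d) by now apply Rinv_0_lt_compat.
    split.
    - apply (arc_fixed f g b d (sg 1) (sg 3) 2 (fun y => above 1 y /\ below 0 y) u B H); auto; [| | | |lra].
      + intros w Hw. apply row_Dom with 1%nat. unfold_row. simpl.
        assert (sg 3 < sg 4) by apply sg_lt_S. repeat split; intros; lra.
      + intros y. split.
        * intros [Y1 Y2]. now apply arc_above_1.
        * intros [w [Y1 Y2]]. eapply arc_row_1; eauto.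
      + intros y [Y1 Y2]. split; [now apply (above_image _ _ _ _ _ _ _ H Y1)|now apply (below_image _ _ _ _ _ _ _ H Y2)].
      + intros y [Y1 Y2]. split; [now apply (above_image _ _ _ _ _ _ _ H' Y1)|now apply (below_image _ _ _ _ _ _ _ H' Y2)].
    - apply (arc_fixed f g b d (sg 1) (sg 2) 1 (fun y => above 0 y /\ below 1 y) u Tp H); auto.
      + intros w Hw. apply row_Dom with 0%nat. unfold_row. simpl. rewrite sg_0, sg_1 in *. repeat split; intros; lra.
      + intros y. split.
        * intros [Y1 Y2]. now apply arc_above_0.
        * intros [w [Y1 Y2]]. eapply arc_row_0; eauto.
      + intros y [Y1 Y2]. split; [now apply (above_image _ _ _ _ _ _ _ H Y1)|now apply (below_image _ _ _ _ _ _ _ H Y2)].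
      + intros y [Y1 Y2]. split; [now apply (above_image _ _ _ _ _ _ _ H' Y1)|now apply (below_image _ _ _ _ _ _ _ H' Y2)]. }
  destruct (cyl_path 1 (u, sg 2) B (0, lam) 1) as [c [C0 C1]]; auto.
  { intros t Ht. destruct (Req_dec t 1) as [->|N].
    - exists Tp. replace (padd (u, sg 2) (pscale 1 (0, lam))) with (u, sg 3); auto.
      rewrite sg_3, sg_2. apply pt_eq; simpl; ring.
    - apply cyl_exists. simpl. rewrite sg_3, sg_2. nra. }
  assert (Ec1 : c 1 = Tp).
  { apply cyl_fun with (m := 1%nat) (p := padd (u, sg 2) (pscale 1 (0, lam))); [apply C1; lra|].
    replace (padd (u, sg 2) (pscale 1 (0, lam))) with (u, sg 3); auto.
    rewrite sg_3, sg_2. apply pt_eq; simpl; ring. }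
  assert (Sc : straight 1 (0, lam) c) by (eapply straight_cyl; eauto).
  (* For [d < 1] the image of the segment would end strictly inside cylinder 1, although its end
     [Tp] is fixed. *)
  assert (GE : forall f g b d, horizontal_pair f g 1 b d -> 0 < d -> 1 <= d).
  { clear f g b d H Hd. intros f g b d H Hd. apply Rnot_lt_le. intros L.
    destruct (FIX _ _ _ _ H Hd) as [FB FT].
    destruct (cyl_path_interior 1 (u, sg 2) B (mapply (mkMat 1 b 0 d) (0, lam)) 1) as [c' [C0' C1']]; auto.
    { intros t Ht. simpl. rewrite sg_3, sg_2. assert (0 < t * d * lam) by (repeat apply Rmult_lt_0_compat; lra).
      assert (t * d < 1) by nra. nra. }
    assert (E : f (c 1) = c' 1).
    { apply (straight_unique 1 (mapply (mkMat 1 b 0 d) (0, lam)) (fun t => f (c t)) c'); try lra.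
      - apply straight_image; [apply H|auto].
      - eapply straight_cyl; eauto.
      - congruence. }
    rewrite Ec1, FT in E. pose proof (C1' 1 ltac:(lra)) as K. rewrite <- E in K.
    destruct (cyl_inj _ _ _ _ CT K) as [K1 _]. simpl in K1. rewrite sg_3, sg_2 in K1. nra. }
  assert (Ed : d = 1).
  { apply Rle_antisym; [|eapply GE; eauto].
    pose proof (horizontal_pair_sym _ _ _ _ _ H) as H'. rewrite Rinv_1 in H'.
    apply GE in H'; [|now apply Rinv_0_lt_compat].
    apply (Rmult_le_compat_l d) in H'; [|lra]. rewrite Rinv_r in H'; lra. }
  split; auto. subst d. destruct (FIX _ _ _ _ H Hd) as [FB FT].
  (* Time 1 is left out because the slanted image then meets the top, where it might hit a vertex
     and [cyl_exists] gives nothing. The end is reached from [Tp] by stepping back [eta]. *)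
  assert (E : forall t, 0 <= t < 1 -> cyl 1 (u + t * (b * lam), sg 2 + t * lam) (f (c t))).
  { intros t Ht.
    destruct (cyl_path_interior 1 (u, sg 2) B (mapply (mkMat 1 b 0 1) (0, lam)) t) as [c' [C0' C1']]; auto.
    { intros s0 Hs. simpl. rewrite sg_3, sg_2. nra. }
    rewrite (straight_unique t (mapply (mkMat 1 b 0 1) (0, lam)) (fun t => f (c t)) c'); try lra.
    - replace (u + t * (b * lam), sg 2 + t * lam) with (padd (u, sg 2) (pscale t (mapply (mkMat 1 b 0 1) (0, lam)))).
      + apply C1'. lra.
      + apply pt_eq; simpl; ring.
    - apply straight_image; [apply H|]. eapply straight_restrict; eauto. lra.
    - eapply straight_cyl; eauto.
    - congruence. }
  assert (Sf : straight 1 (b * lam, lam) (fun t => f (c t))).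
  { replace (b * lam, lam) with (mapply (mkMat 1 b 0 1) (0, lam)) by (apply pt_eq; simpl; ring).
    apply straight_image; [apply H|auto]. }
  destruct (Sf 1 ltac:(lra)) as [e1 [He1 L1]].
  destruct (disp_cyl _ _ _ CT) as [e2 [He2 L2]].
  destruct (small_pscale e2 (b * lam, lam) He2) as [e3 [He3 L3]].
  set (eta := Rmin e1 (Rmin e3 1) / 2).
  assert (Heta : 0 < eta /\ eta < e1 /\ eta < e3 /\ eta < 1).
  { pose proof (Rmin_l e1 (Rmin e3 1)). pose proof (Rmin_r e1 (Rmin e3 1)).
    pose proof (Rmin_l e3 1). pose proof (Rmin_r e3 1).
    assert (0 < Rmin e1 (Rmin e3 1)) by (repeat apply Rmin_glb_lt; lra). unfold eta. lra. }
  clearbody eta.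
  assert (Dt : Rabs (1 - eta - 1) = eta) by (rewrite Rabs_left; lra).
  specialize (L1 (1 - eta) ltac:(lra) ltac:(lra)). simpl in L1. rewrite Ec1, FT in L1.
  apply L2 in L1; [|apply L3; lra|simpl; rewrite sg_3, sg_2; nra].
  destruct (cyl_inj _ _ _ _ (E (1 - eta) ltac:(lra)) L1) as [_ [z Hz]].
  exists (- z)%Z. rewrite opp_IZR. simpl in Hz. lra.
Qed.
End Horizontal.

(** * The Veech group *)

Lemma mat_eq A B : a11 A = a11 B -> a12 A = a12 B -> a21 A = a21 B -> a22 A = a22 B -> A = B.
Proof. destruct A, B. simpl. congruence. Qed.

Lemma minv_mmul_cancel A B : mdet A <> 0 -> mmul (minv A) (mmul A B) = B.
Proof. intros H. unfold mdet in H. apply mat_eq; simpl; unfold mdet; field; exact H. Qed.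

Lemma gen_by_mdet S A : (forall M, S M -> mdet M = 1) -> gen_by S A -> mdet A = 1.
Proof.
  intros HS H. induction H; auto.
  - unfold mdet, mid. simpl. ring.
  - rewrite mdet_mmul, IHgen_by1, IHgen_by2. ring.
  - rewrite mdet_minv; rewrite IHgen_by; lra.
Qed.

Section VeechGroup.
Context {k : nat} {lam : R} (Hk : (2 <= k)%nat) (Hkl : is_lambda_kl k 1 lam).
Local Notation tau := (INR k * (lam + 1)).
Local Notation gens := (fun M => M = Pmat k lam \/ M = Rmat).
Local Notation circ := (circum lam).

Lemma tau_eq : tau = / lam + 1 + lam.
Proof. destruct Hkl as [_ ->]. simpl. ring. Qed.

(** If [lam >= 2/3], then [(k - 1) (lam + 1) >= 5/3], whereas [1 / lam <= 3/2]. *)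
Lemma lambda_k1_ratio : ladder_ratio lam.
Proof.
  pose proof tau_eq as E. destruct Hkl as [H0 _]. split; [easy|].
  apply le_INR in Hk. simpl in Hk. apply Rnot_le_lt. intros L.
  assert (/ lam <= / (2 / 3)) by (apply Rinv_le_contravar; lra).
  replace (/ (2 / 3)) with (3 / 2) in H by field. nra.
Qed.
Local Existing Instance lambda_k1_ratio.

(** Cylinder 1 has height [lam], so P is a single twist in it; this is why that cylinder detects the
    exponent of P. *)
Lemma circ_1_eq : circ 1 = lam * tau.
Proof. pose proof (lam_pos (lam := lam)). rewrite circ_S, tau_eq. simpl. field. lra. Qed.

Lemma gens_mdet A : gen_by gens A -> mdet A = 1.
Proof. apply gen_by_mdet. intros M [->| ->]; unfold mdet; simpl; ring. Qed.

Lemma gens_derivative A : gen_by gens A -> derivative lam A.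
Proof.
  pose proof (lam_pos (lam := lam)). intros HA. induction HA as [M [->| ->]| | |].
  - apply derivative_twist. intros [|n].
    (* P twists [k] times in cylinder 0 and once in every other cylinder. *)
    + exists (Z.of_nat k). rewrite <- INR_IZR_INZ, circ_0. simpl. ring.
    + exists 1%Z. rewrite circ_S, tau_eq. simpl. field. lra.
  - apply derivative_Rmat.
  - apply derivative_mid.
  - now apply derivative_mmul.
  - now apply derivative_minv.
Qed.

Lemma gens_shear n : gen_by gens (mkMat 1 (IZR n * tau) 0 1).
Proof.
  assert (K : forall m : nat, gen_by gens (mkMat 1 (INR m * tau) 0 1)).
  { induction m as [|m IH].
    - replace (mkMat 1 (INR 0 * tau) 0 1) with mid; [apply gen_one|]. apply mat_eq; simpl; ring.
    - replace (mkMat 1 (INR (S m) * tau) 0 1) with (mmul (Pmat k lam) (mkMat 1 (INR m * tau) 0 1)).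
      + apply gen_mul; auto. apply gen_base. auto.
      + rewrite S_INR. apply mat_eq; simpl; ring. }
  destruct (Z_le_gt_dec 0 n) as [L|L].
  - rewrite <- (Z2Nat.id n L), <- INR_IZR_INZ. apply K.
  - replace (mkMat 1 (IZR n * tau) 0 1) with (minv (mkMat 1 (INR (Z.to_nat (- n)) * tau) 0 1)).
    + apply gen_inv, K.
    + rewrite INR_IZR_INZ, Z2Nat.id, opp_IZR by lia. apply mat_eq; simpl; unfold mdet; simpl; field.
Qed.

(* Euclidean algorithm on the first column: translations by [tau] bring its slope quotient into
   [[-1 - lam, lam]], the cone [(lam, 1/lam)] being excluded, and a power of R then shrinks the
   lower entry. *)
Lemma reduce_column N A : derivative lam A ->
  Rabs (a21 A) < mdet A / (4 * circ 1) * (3 / 2) ^ N ->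
  exists g, gen_by gens g /\ a21 (mmul g A) = 0.
Proof.
  pose proof (lam_pos (lam := lam)) as L0. pose proof (lam_lt (lam := lam)) as L1.
  pose proof (circ_pos (lam := lam) 1) as Hc.
  revert A. induction N as [|N IH]; intros A HA Hlt.
  (* For [N = 0] the assumed bound contradicts [height_bounded_below] unless the entry already
     vanishes. *)
  - exists mid. split; [apply gen_one|].
    replace (a21 (mmul mid A)) with (a21 A) by (simpl; ring). apply NNPP. intros Hy.
    destruct HA as [f [Hf Hdet]]. apply affine_with_iff in Hf as [[g [Hgf _]] Hf].
    pose proof (height_bounded_below f g A Hf Hgf Hdet Hy) as B.
    simpl in Hlt. apply (Rmult_lt_compat_r (4 * circ 1)) in Hlt; [|lra].
    replace (mdet A / (4 * circ 1) * 1 * (4 * circ 1)) with (mdet A) in Hlt by (field; lra). lra.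
  - destruct (Req_dec (a21 A) 0) as [Hy|Hy].
    { exists mid. split; [apply gen_one|]. simpl. rewrite Hy. ring. }
    set (q := a11 A / a21 A).
    assert (Ht : 0 < tau) by (rewrite tau_eq; pose proof (Rinv_0_lt_compat lam L0); lra).
    destruct (shift_into (-1 - lam) q tau Ht) as [n Hn].
    set (P := mkMat 1 (IZR n * tau) 0 1). set (B := mmul P A).
    assert (HP : gen_by gens P) by apply gens_shear.
    assert (HB : derivative lam B) by (apply derivative_mmul; auto; now apply gens_derivative).
    assert (B2 : a21 B = a21 A) by (unfold B, P; simpl; ring).
    assert (B1 : a11 B = (q + IZR n * tau) * a21 B) by (rewrite B2; unfold B, P, q; simpl; field; auto).
    set (q' := q + IZR n * tau) in *.
    assert (Hq' : q' <= lam).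
    { apply Rnot_lt_le. intros L. destruct HB as [f [Hf Hdet]].
      apply affine_with_iff in Hf as [[g [_ Hfg]] Hf].
      apply (cone_direction f g B q'); auto; [now rewrite B2|].
      assert (E : q' < / lam) by (pose proof tau_eq; lra).
      apply (Rmult_lt_compat_l lam) in E; auto. rewrite Rinv_r in E; lra. }
    assert (Step : forall h, gen_by gens h -> Rabs (a21 (mmul h B)) <= 2 / 3 * Rabs (a21 A) ->
      exists g, gen_by gens g /\ a21 (mmul g A) = 0).
    { intros h Hh Hle. destruct (IH (mmul h B)) as [g [Hg1 Hg2]].
      - apply derivative_mmul; auto. now apply gens_derivative.
      - unfold B. rewrite !mdet_mmul, (gens_mdet h Hh), (gens_mdet P HP), !Rmult_1_l. simpl in Hlt. fold B. lra.
      - exists (mmul g (mmul h P)). split; [repeat apply gen_mul; auto|].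
        rewrite <- Hg2. unfold B. simpl. ring. }
    pose proof (Rabs_pos (a21 A)) as Ha.
    assert (HR : gen_by gens Rmat) by (apply gen_base; auto).
    destruct (Rle_dec (- (2 / 3)) q') as [Q|Q].
    + apply (Step Rmat HR).
      replace (a21 (mmul Rmat B)) with (q' * a21 A) by (rewrite <- B2, <- B1; simpl; ring).
      rewrite Rabs_mult. apply Rmult_le_compat_r; auto. apply Rabs_le. lra.
    + apply (Step (mmul Rmat Rmat)); [now apply gen_mul|].
      replace (a21 (mmul (mmul Rmat Rmat) B)) with (- (q' + 1) * a21 A).
      * rewrite Rabs_mult. apply Rmult_le_compat_r; auto. apply Rabs_le. lra.
      * rewrite <- B2. replace (- (q' + 1) * a21 B) with (- a11 B - a21 B) by (rewrite B1; ring).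
        simpl. ring.
Qed.

Lemma derivative_upper_triangular A : derivative lam A -> a21 A = 0 -> gen_by gens A.
Proof.
  pose proof (lam_pos (lam := lam)) as L0.
  intros [f [Hf Hdet]] Hy. apply affine_with_iff in Hf as [[g [Hgf Hfg]] Hf].
  assert (Had : 0 < a11 A * a22 A) by (unfold mdet in Hdet; rewrite Hy in Hdet; lra).
  assert (Ha : a11 A <> 0) by nra. assert (Hd : a22 A <> 0) by nra.
  pose proof (affine_map_inv f g A ltac:(lra) Hf Hgf Hfg) as Hg.
  destruct (horizontal_shear f g (a11 A) (a12 A) (a22 A)) as [E1 [E2 [N E3]]].
  - split; [|split].
    + replace (mkMat (a11 A) (a12 A) 0 (a22 A)) with A; auto. apply mat_eq; auto.
    + replace (mkMat (/ a11 A) (- (a12 A / (a11 A * a22 A))) 0 (/ a22 A)) with (minv A); auto.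
      apply mat_eq; simpl; unfold mdet; rewrite Hy; field; auto.
    + auto.
  - replace A with (mkMat 1 (IZR N * tau) 0 1); [apply gens_shear|].
    apply mat_eq; simpl; auto. rewrite circ_1_eq in E3.
    apply Rmult_eq_reg_r with lam; lra.
Qed.

Lemma derivative_gens A : derivative lam A -> gen_by gens A.
Proof.
  intros HA. pose proof (circ_pos (lam := lam) 1) as Hc.
  assert (Hdet : 0 < mdet A) by (destruct HA as [f [_ H]]; exact H).
  assert (Hm : 0 < mdet A / (4 * circ 1)) by (apply Rdiv_lt_0_compat; lra).
  destruct (Pow_x_infinity (3 / 2) ltac:(rewrite Rabs_right; lra) (Rabs (a21 A) / (mdet A / (4 * circ 1)) + 1)) as [N HN].
  specialize (HN N (Nat.le_refl N)). rewrite Rabs_right in HN by (left; apply pow_lt; lra).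
  destruct (reduce_column N A HA) as [g [Hg1 Hg2]].
  - set (m := mdet A / (4 * circ 1)) in *.
    replace (Rabs (a21 A)) with (m * (Rabs (a21 A) / m)) by (field; lra).
    apply Rmult_lt_compat_l; lra.
  - rewrite <- (minv_mmul_cancel g A) by (rewrite (gens_mdet g Hg1); lra).
    apply gen_mul; [now apply gen_inv|]. apply derivative_upper_triangular; auto.
    apply derivative_mmul; auto. now apply gens_derivative.
Qed.
End VeechGroup.

Theorem mainTheorem5 (k : nat) (lam : R) :
  (2 <= k)%nat -> is_lambda_kl k 1 lam ->
  (forall A : Mat, derivative lam A ->
     exists g, gen_by (fun M => M = Pmat k lam \/ M = Rmat) g /\
               (A = g \/ A = mopp g)) /\
  (forall g : Mat, gen_by (fun M => M = Pmat k lam \/ M = Rmat) g ->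
     derivative lam g \/ derivative lam (mopp g)).
Proof.
  intros Hk Hkl. split.
  (* The matrix itself serves as [g]: by [horizontal_orientation] an upper triangular derivative has
     [a = 1], so no sign ambiguity arises. *)
  - intros A HA. exists A. split; auto. now apply derivative_gens.
  - intros g Hg. left. eapply gens_derivative; eauto.
Qed.
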